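(* Let $N\ge 2$. (i) Let $1\le p\le N$. For every $0<\beta<1$ there exists a constant $\alpha_{N,p,\beta}>0$, depending only on $N,p,\beta$, such that for every nonempty open set $\Omega\subseteq\mathbb{R}^N$ with $\lambda_p(\Omega)>0$ there exists a ball $B_r(x_0)$ with radius $$r\ge\frac{\alpha_{N,p,\beta}}{\big(\lambda_p(\Omega)\big)^{1/p}}$$ such that $$|B_r(x_0)\cap\Omega|\ge\beta\,|B_r(x_0)|.$$ The constant $\alpha_{N,p,\beta}$ is such that $\alpha_{N,p,\beta}\sim(1-\beta)^{1/p}$ as $\beta\nearrow1$. (ii) Let $p>N$ (with $p<\infty$). There exists a constant $\alpha_{N,p}>0$, depending only on $N,p$, such that for every nonempty open set $\Omega\subseteq\mathbb{R}^N$ with $\lambda_p(\Omega)>0$ there exists a ball $B_r(x_0)$ with radius $$r\ge\frac{\alpha_{N,p}}{\big(\lambda_p(\Omega)\big)^{1/p}}$$ such that $B_r(x_0)\subseteq\Omega$.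
   Context: For $1\le p<\infty$ and an open set $\Omega\subseteq\mathbb{R}^N$, $$\lambda_p(\Omega)=\inf_{\varphi\in C^\infty_0(\Omega)}\Big\{\int_\Omega|\nabla\varphi|^p\,dx:\ \|\varphi\|_{L^p(\Omega)}=1\Big\}.$$ $B_r(x_0)=\{x\in\mathbb{R}^N:|x-x_0|<r\}$ and $|\cdot|$ denotes Lebesgue measure of sets. The relation $f(\beta)\sim g(\beta)$ as $\beta\nearrow1$ means that $f/g$ stays between two positive constants (depending only on $N$ and $p$) for $\beta$ close to $1$. *)

(* Defs.v *)
From HB Require Import structures.
From mathcomp Require Import all_boot all_order all_algebra.
From mathcomp Require Import all_classical all_reals all_analysis.

Set Implicit Arguments.
Unset Strict Implicit.
Unset Printing Implicit Defensive.

Import Order.TTheory GRing.Theory Num.Theory.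
Import numFieldNormedType.Exports.

Local Open Scope classical_set_scope.
Local Open Scope ring_scope.

(* The library norm on 'rV[R]_N is the maximum norm. It is used below only     *)
(* through the topology and the derivatives; balls and the length of the       *)
(* gradient refer to the Euclidean norm enorm.                                 *)

(* R^N carries the sigma-algebra generated by the coordinates, which is the    *)
(* Borel sigma-algebra. Its N-dimensional Lebesgue measure lebesgue_rV is the  *)
(* N-fold product of lebesgue_measure, transported along (x, v) |-> x :: v;    *)
(* lebesgue_rV_box is its value on measurable boxes.                           *)

Fact measure_rV_display : measure_display. Proof. by []. Qed.

Section measurable_rV.
Variables (R : realType) (N : nat).

Let coors : 'I_N -> 'rV[R]_N -> R := fun i x => x 0 i.

Let rV_set0 : g_sigma_preimage coors set0.
Proof. exact: sigma_algebra0. Qed.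

Let rV_setC A : g_sigma_preimage coors A -> g_sigma_preimage coors (~` A).
Proof. exact: sigma_algebraC. Qed.

Let rV_bigcup (F : (set 'rV[R]_N)^nat) :
  (forall i, g_sigma_preimage coors (F i)) ->
  g_sigma_preimage coors (\bigcup_i (F i)).
Proof. exact: sigma_algebra_bigcup. Qed.

HB.instance Definition _ := @isMeasurable.Build measure_rV_display
  'rV[R]_N (g_sigma_preimage coors) rV_set0 rV_setC rV_bigcup.

Lemma measurable_coord (i : 'I_N) :
  measurable_fun [set: 'rV[R]_N] (fun x : 'rV[R]_N => x 0 i).
Proof.
move=> _ Y mY; rewrite setTI; apply: sub_sigma_algebra => /=.
rewrite -bigcup_seq/=; exists i => /=; first by rewrite mem_index_enum.
by exists Y => //; rewrite setTI.
Qed.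

Lemma measurable_fun_rVP d (T : measurableType d) (f : T -> 'rV[R]_N) :
  measurable_fun [set: T] f <->
  forall i, measurable_fun [set: T] (fun t => f t 0 i).
Proof.
split=> [mf i|mf _ A mA].
  exact: (measurableT_comp (measurable_coord i) mf).
rewrite setTI; suff: g_sigma_preimage coors `<=` [set B | measurable (f @^-1` B)].
  exact.
apply: smallest_sub.
  split=> [|B mB|F mF] /=.
  - by rewrite preimage_set0.
  - by rewrite setTD preimage_setC; exact: measurableC.
  - by rewrite preimage_bigcup; exact: bigcupT_measurable.
rewrite -bigcup_seq => B [i _ [C mC <-]] /=.
rewrite setTI -comp_preimage -[X in measurable X]setTI.
exact: mf.
Qed.

End measurable_rV.

Section cons_rV.
Variables (R : realType) (N : nat).

Definition cons_rV (xv : R * 'rV[R]_N) : 'rV[R]_N.+1 :=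
  row_mx (const_mx xv.1 : 'rV_1) xv.2.

Lemma cons_rV0 xv : cons_rV xv 0 0 = xv.1.
Proof.
have -> : (0 : 'I_(1 + N)) = lshift N 0 by exact/val_inj.
by rewrite (@row_mxEl _ 1 1 N) mxE.
Qed.

Lemma cons_rVS xv j : cons_rV xv 0 (lift ord0 j) = xv.2 0 j.
Proof.
have -> : lift ord0 j = rshift 1 j by exact/val_inj.
exact: (@row_mxEr _ 1 1 N).
Qed.

Definition uncons_rV (x : 'rV[R]_N.+1) : R * 'rV[R]_N :=
  (x 0 0, \row_j x 0 (lift ord0 j)).

Lemma cons_rVK : cancel cons_rV uncons_rV.
Proof.
move=> [x v]; rewrite /uncons_rV cons_rV0; congr pair.
by apply/rowP => j; rewrite mxE cons_rVS.
Qed.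

Lemma uncons_rVK : cancel uncons_rV cons_rV.
Proof.
move=> x; apply/rowP => i; have [j ->|->] := unliftP ord0 i.
  by rewrite cons_rVS mxE.
by rewrite cons_rV0.
Qed.

Lemma measurable_cons_rV : measurable_fun [set: R * 'rV[R]_N] cons_rV.
Proof.
apply/measurable_fun_rVP => i; have [j ->|->] := unliftP ord0 i.
  under eq_fun do rewrite cons_rVS.
  exact: (measurableT_comp (measurable_coord j) measurable_snd).
under eq_fun do rewrite cons_rV0.
exact: measurable_fst.
Qed.

Lemma measurable_uncons_rV : measurable_fun [set: 'rV[R]_N.+1] uncons_rV.
Proof.
apply: measurable_fun_pair; first exact: measurable_coord.
apply/measurable_fun_rVP => j; under eq_fun do rewrite mxE.
exact: measurable_coord.
Qed.

End cons_rV.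

Section lebesgue_cons.
Local Open Scope ereal_scope.
Variables (R : realType) (N : nat).
Variable mu : {sigma_finite_measure set 'rV[R]_N -> \bar R}.

Definition lebesgue_cons : set 'rV[R]_N.+1 -> \bar R :=
  pushforward (@lebesgue_measure R \x mu) (@cons_rV R N).

Let lebesgue_cons0 : lebesgue_cons set0 = 0.
Proof. by rewrite /lebesgue_cons /pushforward preimage_set0 measure0. Qed.

Let lebesgue_cons_ge0 A : 0 <= lebesgue_cons A.
Proof. by rewrite /lebesgue_cons /pushforward measure_ge0. Qed.

Let lebesgue_cons_sigma_additive : semi_sigma_additive lebesgue_cons.
Proof.
have mc (A : set 'rV[R]_N.+1) : measurable A ->
    measurable (@cons_rV R N @^-1` A).
  by move=> mA; rewrite -[X in measurable X]setTI; exact: measurable_cons_rV.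
move=> F mF tF mUF; rewrite /lebesgue_cons /pushforward preimage_bigcup.
apply: measure_semi_sigma_additive.
- by move=> n; exact: mc.
- apply/trivIsetP => /= i j _ _ ij; rewrite -preimage_setI.
  by move/trivIsetP : tF => /(_ _ _ _ _ ij) ->//; rewrite preimage_set0.
- by rewrite -preimage_bigcup; exact: mc.
Qed.

HB.instance Definition _ := isMeasure.Build _ _ _ lebesgue_cons
  lebesgue_cons0 lebesgue_cons_ge0 lebesgue_cons_sigma_additive.

Lemma lebesgue_cons_setX (A : set R) (B : set 'rV[R]_N) :
  measurable A -> measurable B ->
  lebesgue_cons (@uncons_rV R N @^-1` (A `*` B)) = lebesgue_measure A * mu B.
Proof.
move=> mA mB; rewrite -product_measure1E// /lebesgue_cons /pushforward.
rewrite -comp_preimage (_ : _ \o _ = id) ?preimage_id//.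
by apply/funext => x /=; rewrite cons_rVK.
Qed.

Let lebesgue_cons_sigma_finite : sigma_finite setT lebesgue_cons.
Proof.
have /sigma_finiteP[F [TF ndF Foo]] := sigma_finiteT (@lebesgue_measure R).
have /sigma_finiteP[G [TG ndG Goo]] := sigma_finiteT mu.
exists (fun n => @uncons_rV R N @^-1` (F n `*` G n)).
  rewrite -preimage_bigcup (_ : \bigcup_n _ = setT) ?preimage_setT//.
  apply/seteqP; split => // -[x v] _.
  have [n _ Fnx] : (\bigcup_n F n) x by rewrite -TF.
  have [k _ Gkv] : (\bigcup_n G n) v by rewrite -TG.
  exists (maxn n k) => //; split.
    by move: x Fnx; exact/subsetPset/ndF/leq_maxl.
  by move: v Gkv; exact/subsetPset/ndG/leq_maxr.
move=> k; have [mF Fk] := Foo k; have [mG Gk] := Goo k; split.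
  rewrite -[X in measurable X]setTI; apply: measurable_uncons_rV => //.
  exact: measurableX.
by rewrite lebesgue_cons_setX// lte_mul_pinfty// ge0_fin_numE.
Qed.

HB.instance Definition _ := Measure_isSigmaFinite.Build _ _ _ lebesgue_cons
  lebesgue_cons_sigma_finite.

End lebesgue_cons.

Fixpoint lebesgue_rV (R : realType) (N : nat) :
    {sigma_finite_measure set 'rV[R]_N -> \bar R} :=
  match N with
  | 0 => \d_(0 : 'rV[R]_0)
  | N'.+1 => lebesgue_cons (lebesgue_rV R N')
  end.

Lemma measurable_rV_box (R : realType) (N : nat) (A : 'I_N -> set R) :
  (forall i, measurable (A i)) ->
  measurable [set x : 'rV[R]_N | forall i, A i (x ord0 i)].
Proof.
move=> mA.
rewrite (_ : mkset _ = \bigcap_i ((fun x : 'rV[R]_N => x 0 i) @^-1` A i)).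
  apply: fin_bigcap_measurable => // i _.
  by rewrite -[X in measurable X]setTI; exact: measurable_coord.
by apply/seteqP; split => x xA i => [_|]; [exact: xA|exact: (xA i I)].
Qed.

Lemma lebesgue_rV_box (R : realType) (N : nat) (A : 'I_N -> set R) :
  (forall i, measurable (A i)) ->
  (lebesgue_rV R N [set x : 'rV[R]_N | forall i, A i (x ord0 i)] =
   \prod_(i < N) lebesgue_measure (A i))%E.
Proof.
elim: N A => [|N IHN] A mA.
  rewrite big_ord0 (_ : mkset _ = setT) /= ?diracT//.
  by apply/seteqP; split => // x _ [].
rewrite big_ord_recl -IHN// -lebesgue_cons_setX//=; last first.
  exact: (@measurable_rV_box R N (fun i => A (lift ord0 i))
    (fun i => mA (lift ord0 i))).
congr lebesgue_cons; apply/seteqP; split => x /=.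
  by move=> xA; split => // i; rewrite mxE.
move=> [xA0 xA] i; have [j ->|-> //] := unliftP ord0 i.
by have := xA j; rewrite mxE.
Qed.

Section euclidean.
Context {R : realType} {N : nat}.
Implicit Types (f : 'rV[R]_N -> R) (O : set 'rV[R]_N) (p : R).

Definition enorm (x : 'rV[R]_N) : R := Num.sqrt (\sum_(i < N) x 0 i ^+ 2).

Definition eball (x0 : 'rV[R]_N) (r : R) : set 'rV[R]_N :=
  [set x | enorm (x - x0) < r].

Definition basis_rV (i : 'I_N) : 'rV[R]_N := delta_mx 0 i.

Definition grad f (x : 'rV[R]_N) : 'rV[R]_N := \row_i 'D_(basis_rV i) f x.

Fixpoint Ck (k : nat) f : Prop :=
  match k with
  | 0 => continuous f
  | k'.+1 => continuous f /\
      forall i, (forall x, derivable f x (basis_rV i)) /\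
                Ck k' ('D_(basis_rV i) f)
  end.

Definition smooth f : Prop := forall k, Ck k f.

(* C_0^oo(O): smooth functions with compact support included in O, each        *)
(* extended by zero to the whole space.                                        *)
Definition test_function O : set ('rV[R]_N -> R) :=
  [set f | [/\ smooth f, compact (closure [set x | f x != 0]) &
    closure [set x | f x != 0] `<=` O]].

Definition lambda p O : \bar R :=
  ereal_inf [set (\int[lebesgue_rV R N]_(x in O) (enorm (grad f x) `^ p)%:E)%E |
    f in [set f | test_function O f /\
                  ('N[lebesgue_rV R N]_(p%:E)[EFin \o (f \_ O)] = 1)%E]].

End euclidean.

(* f ~ g at 1 from the left: the ratio stays between two positive constants.   *)
Definition sim_at1 (R : realType) (f g : R -> R) : Prop :=
  exists c C : R, [/\ 0 < c, 0 < C & \forall b \near 1^'-, c <= f b / g b <= C].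

(* Main.v *)
Require Import Defs.
From HB Require Import structures.
From mathcomp Require Import all_boot all_order all_algebra.
From mathcomp Require Import all_classical all_reals all_analysis measurable_realfun.
From mathcomp Require Import lra ring.

(** Both parts rest on the translation estimate
      int_S |u(w + h) - u(w)|^p dw <= (N d)^p int_S' |grad u|^p
    for |h_j| <= d, where S' contains the d-neighbourhood of S.

    (i) If every ball B_r(x) meets the complement of Omega in a proportion
    larger than 1 - beta, then integrating the estimate over h in B_r and
    keeping only those h with u(x + h) = 0 gives
      (1 - beta) int |u|^p <= (N r)^p int |grad u|^p.

    (ii) For p > N, iterate I(s) = int_{|w_j| < s} |u(x + w) - u(x)|^p dw over
    the scales s, s/2, s/4, ...: the translation estimate bounds I(s) by a
    constant times I(s/2) plus a gradient term, and since p > N the resulting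
    series converges, so I(r) <= K r^p int |grad u|^p near x.  If every ball
    B_r(x) contains a zero x + h of u, comparing I at x and at x + h bounds
    |u(x)|^p, and integrating in x gives int |u|^p <= C r^p int |grad u|^p. *)

Set Implicit Arguments.
Unset Strict Implicit.
Unset Printing Implicit Defensive.

Import Order.TTheory GRing.Theory Num.Theory.
Import numFieldNormedType.Exports.

Local Open Scope classical_set_scope.
Local Open Scope ring_scope.

(** * Borel sets and translation invariance *)

Section measure_rV.
Variable R : realType.

Let close_trans (x y q d e : R) : x - d < q -> q < x + d ->
  q - d < y -> y < q + d -> d < e / 2 -> `|x - y| < e.
Proof. by move=> *; rewrite ltr_norml; apply/andP; split; lra. Qed.

(** The sigma-algebra is generated by the coordinates, so A is exhausted by countably many boxes:
    those with rational centre and half-side 1/(n+1) that are included in A. *)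
Lemma open_measurable_rV N (A : set 'rV[R]_N) : open A -> measurable A.
Proof.
move=> oA.
pose box (q : 'rV[rat]_N) (n : nat) : set 'rV[R]_N :=
  [set x | forall j, x ord0 j \in `](ratr (q ord0 j) - n.+1%:R^-1), (ratr (q ord0 j) + n.+1%:R^-1)[].
have mbox q n : measurable (box q n).
  exact: (@measurable_rV_box R N (fun j => [set` `](ratr (q ord0 j) - n.+1%:R^-1), (ratr (q ord0 j) + n.+1%:R^-1)[])).
have -> : A = \bigcup_(q in [set: 'rV[rat]_N]) \bigcup_(n in [set n | box q n `<=` A]) box q n.
  apply/seteqP; split => [x Ax|x [q _ [n +]]]; last exact.
  have /nbhs_ballP [e /= e0 xeA] : nbhs x A by exact: open_nbhs_nbhs.
  have [n ne] : exists n : nat, (n.+1%:R^-1 : R) < (e : R) / (2 : R).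
    by have [n _ /(_ n (leqnn n))] := near_infty_natSinv_lt (PosNum (divr_gt0 e0 (ltr0Sn R 1))); exists n.
  have /choice [q xq] : forall j, exists q : rat, ratr q \in `](x ord0 j - n.+1%:R^-1), (x ord0 j + n.+1%:R^-1)[.
    by move=> j; apply: rat_in_itvoo; rewrite ltrBlDr -addrA ltrDl addr_gt0 ?invr_gt0.
  exists (\row_j q j) => //; exists n => /= [y yb|j].
    apply: xeA; split=> // i j; rewrite (ord1 i : i = ord0); have := yb j; have := xq j.
    rewrite !mxE !in_itv/= => /andP[a1 a2] /andP[b1 b2].
    exact: (close_trans a1 a2 b1 b2 ne).
  by have := xq j; rewrite !mxE !in_itv/= => /andP[a1 a2]; rewrite ltrBlDr a2 -ltrBlDr a1.
by apply: countable_bigcupT_measurable => [|q]; [exact: countableP|exact: bigcup_measurable].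
Qed.

Lemma continuous_measurable_rV N (f : 'rV[R]_N -> R) :
  continuous f -> measurable_fun setT f.
Proof.
move=> /continuousP cf; apply: (measurability _ (RGenOpens.measurableE R)).
move=> _ [_ [a [b ->] <-]]; rewrite setTI; apply: open_measurable_rV.
exact/cf/interval_open.
Qed.

Lemma measurable_funD_rV d (T : measurableType d) N (f g : T -> 'rV[R]_N) :
  measurable_fun setT f -> measurable_fun setT g ->
  measurable_fun setT (fun x => f x + g x).
Proof.
move=> /measurable_fun_rVP mf /measurable_fun_rVP mg; apply/measurable_fun_rVP => i.
by under eq_fun do rewrite mxE; exact: measurable_funD.
Qed.

Lemma measurable_shift_rV N (h : 'rV[R]_N) :
  measurable_fun setT (fun x : 'rV[R]_N => x + h).
Proof. by apply: measurable_funD_rV. Qed.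

Local Open Scope ereal_scope.

(** The translated measure agrees with Lebesgue measure on half-open intervals, and these determine
    it. *)
Let lebesgue_measure_shift (a : R) (A : set R) : measurable A ->
  pushforward lebesgue_measure (fun x : measurableTypeR R => (x + a)%R : measurableTypeR R) A =
  lebesgue_measure A.
Proof.
move=> mA; apply/esym; apply: lebesgue_measure_unique => //=.
  exact: measurable_funD.
move=> _ _ [[b c]] _ <-.
rewrite /pushforward (_ : _ @^-1` _ = `](b - a)%R, (c - a)%R]%classic).
  by rewrite !lebesgue_measure_itv/= !lte_fin ltrD2r -!EFinB opprB addrA subrK.
by apply/seteqP; split=> x /=; rewrite !in_itv/= ltrBlDr lerBrDr.
Qed.

Lemma ge0_integral_shift (a : R) (f : R -> \bar R) :
  measurable_fun setT f -> (forall x, 0 <= f x) ->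
  \int[lebesgue_measure]_x f (x + a)%R = \int[lebesgue_measure]_x f x.
Proof.
move=> mf f0.
have ma : measurable_fun setT (fun x : measurableTypeR R => (x + a)%R : measurableTypeR R).
  exact: measurable_funD.
rewrite -[LHS](@ge0_integral_pushforward _ _ _ _ _ _ ma _ setT f)//.
by apply: eq_measure_integral => A mA _; exact: lebesgue_measure_shift.
Qed.

Lemma ge0_integral_lebesgue_cons N (mu : {sigma_finite_measure set 'rV[R]_N -> \bar R})
    (f : 'rV[R]_N.+1 -> \bar R) :
  measurable_fun setT f -> (forall x, 0 <= f x) ->
  \int[lebesgue_cons mu]_x f x =
  \int[lebesgue_measure]_t \int[mu]_v f (cons_rV (t, v)).
Proof.
move=> mf f0.
have := @ge0_integral_pushforward _ _ (measurableTypeR R * 'rV[R]_N)%type _ R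
  (@cons_rV R N) (@measurable_cons_rV R N)
  (@lebesgue_measure R \x mu) setT f measurableT mf (fun x _ => f0 x).
rewrite /lebesgue_cons => ->.
rewrite preimage_setT fubini_tonelli1//.
  by apply: measurableT_comp => //; exact: measurable_cons_rV.
by move=> x; exact: f0.
Qed.

(** Induction on the dimension: [cons_rV] splits off the first coordinate, the induction hypothesis
    moves the inner integral, and the one-dimensional invariance moves the outer one. *)
Lemma ge0_integral_shift_rV N (h : 'rV[R]_N) (f : 'rV[R]_N -> \bar R) :
  measurable_fun setT f -> (forall x, 0 <= f x) ->
  \int[lebesgue_rV R N]_x f (x + h)%R = \int[lebesgue_rV R N]_x f x.
Proof.
elim: N h f => [|N IHN] h f mf f0.
  by apply: eq_integral => x _; congr f; apply/rowP => -[].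
have mfh : measurable_fun setT (fun x : 'rV[R]_N.+1 => f (x + h)%R).
  by apply: measurableT_comp => //; exact: measurable_shift_rV.
have mfc : measurable_fun setT (fun z : R * 'rV[R]_N => f (cons_rV z)).
  by apply: measurableT_comp => //; exact: measurable_cons_rV.
have consE F : \int[lebesgue_rV R N.+1]_x F x = \int[lebesgue_cons (lebesgue_rV R N)]_x F x by [].
rewrite !consE !ge0_integral_lebesgue_cons//.
pose h' := (uncons_rV h).2.
have consD t v : (cons_rV (t, v) + h = cons_rV ((t + h ord0 ord0), v + h'))%R.
  have addE n (a b : 'rV[R]_n) i : ((a + b) ord0 i = a ord0 i + b ord0 i)%R by rewrite mxE.
  apply/rowP => i; have [j ->|->] := unliftP ord0 i.
    by rewrite addE !cons_rVS addE mxE.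
  by rewrite addE !cons_rV0.
transitivity (\int[lebesgue_measure]_t
    \int[lebesgue_rV R N]_v f (cons_rV ((t + h ord0 ord0)%R, v))).
  apply: eq_integral => t _; under eq_integral do rewrite consD.
  apply: (IHN h' (fun v => f (cons_rV ((t + h ord0 ord0)%R, v)))) => //.
  exact: (measurableT_comp mfc (pair1_measurable _)).
apply: (@ge0_integral_shift _ (fun t => \int[lebesgue_rV R N]_v f (cons_rV (t, v)))).
  exact: (@measurable_fun_fubini_tonelli_F _ _ _ _ _ _ (fun z => f (cons_rV z))).
by move=> t; exact: integral_ge0.
Qed.

End measure_rV.

(** * Convexity of powers *)

Section powR_inequalities.
Variable R : realType.
Implicit Types a b t p : R.

Lemma powRV p a : 0 <= a -> a^-1 `^ p = (a `^ p)^-1.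
Proof. by move=> a0; rewrite -(powR_inv1 a0) -powRrM mulN1r powRN. Qed.

Lemma powRX p a n : 0 <= a -> (a ^+ n) `^ p = (a `^ p) ^+ n.
Proof. by move=> a0; rewrite -!powR_mulrn ?powR_ge0// powRAC. Qed.

(** Jensen's inequality with weights 1 - t and t at the points a/(1-t) and b/t. Keeping t free lets
    the coefficient of a^p come as close to 1 as wished, which the iteration for p > N exploits. *)
Lemma powRD_le p t a b : 1 <= p -> 0 < t < 1 -> 0 <= a -> 0 <= b ->
  (a + b) `^ p <= (1 - t) `^ (1 - p) * a `^ p + t `^ (1 - p) * b `^ p.
Proof.
move=> p1 /andP[t0 t1] a0 b0.
have s0 : 0 < 1 - t by rewrite subr_gt0.
have split_powR s c : 0 < s -> 0 <= c -> s * (c / s) `^ p = s `^ (1 - p) * c `^ p.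
  move=> s_gt0 c0; rewrite powRM ?invr_ge0 ?(ltW s_gt0)// mulrCA mulrC; congr (_ * _).
  rewrite powRB; last by rewrite (gt_eqF s_gt0) implybT.
  rewrite powRr1 ?(ltW s_gt0)//; congr (_ * _).
  by rewrite powRV// ltW.
have s1 : 1 - t <= 1 by rewrite gerBl ltW.
have := @convex_powR R p p1 (Itv01 (ltW s0) s1) (a / (1 - t)) (b / t).
rewrite !inE/= !in_itv/= !andbT.
move=> /(_ (divr_ge0 a0 (ltW s0)) (divr_ge0 b0 (ltW t0))).
rewrite convRE [X in X `^ _ <= _ -> _]convRE /= /unstable.onem subKr !split_powR//.
by rewrite mulrC divfK ?gt_eqF// mulrC divfK ?gt_eqF.
Qed.

(** Hoelder's inequality for finite sums, by induction. With t = 1/(n+2) in [powRD_le] the last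
    increment gets the weight (n+2)^(p-1), and the factor ((n+1)/(n+2))^(1-p) turns the inherited
    (n+1)^(p-1) into the same weight. *)
Lemma powR_norm_telescope p n (f : nat -> R) : 1 <= p ->
  `|f n - f 0%N| `^ p <= n%:R `^ (p - 1) * \sum_(k < n) `|f k.+1 - f k| `^ p.
Proof.
move=> p1; have p0 : 0 < p by apply: lt_le_trans p1.
elim: n => [|[|n] IHn].
- by rewrite big_ord0 mulr0 subrr normr0 powR0 ?gt_eqF.
- by rewrite big_ord1 powR1 mul1r.
rewrite big_ord_recr /=.
have -> : f n.+2 - f 0%N = (f n.+1 - f 0%N) + (f n.+2 - f n.+1).
  by rewrite [RHS]addrC addrA subrK.
have n2 : (0 : R) < n.+2%:R by rewrite ltr0n.
have t01 : 0 < (n.+2%:R : R)^-1 < 1 by rewrite invr_gt0 n2 invf_lt1// ltr1n.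
apply: (@le_trans _ _ ((`|f n.+1 - f 0%N| + `|f n.+2 - f n.+1|) `^ p)).
  by rewrite ge0_ler_powR ?nnegrE ?(ltW p0) ?addr_ge0// ler_normD.
apply: (le_trans (powRD_le p1 t01 (normr_ge0 _) (normr_ge0 _))).
have E : (n.+2%:R^-1 : R) `^ (1 - p) = n.+2%:R `^ (p - 1).
  by rewrite powRV ?ler0n// -powRN opprB.
rewrite E mulrDr lerD2r.
have -> : 1 - (n.+2%:R^-1 : R) = n.+1%:R / n.+2%:R.
  apply: (mulIf (lt0r_neq0 n2)).
  by rewrite divfK ?lt0r_neq0// mulrBl mul1r mulVf ?lt0r_neq0// -[n.+2%:R]natr1 addrK.
rewrite powRM ?invr_ge0 ?ler0n// E mulrAC mulrC ler_wpM2l ?powR_ge0//.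
rewrite (le_trans (ler_wpM2l (powR_ge0 _ _) IHn))// mulrA -powRD ?pnatr_eq0 ?implybT//.
by rewrite addrA subrK subrr powRr0 mul1r.
Qed.

End powR_inequalities.

(** * Compactly supported functions of class C1 *)

Section C1_compact_support.
Variables (R : realType) (N : nat) (u : 'rV[R]_N -> R).
Hypothesis u1 : Ck 1 u.
Hypothesis supp_u : compact (closure [set x | u x != 0]).

Local Notation e_ i := (basis_rV i : 'rV[R]_N).

Lemma C1_continuous : continuous u.
Proof. by case: u1. Qed.

Lemma C1_derivable i x : derivable u x (e_ i).
Proof. by case: u1 => _ /(_ i) []. Qed.

Lemma C1_partial_continuous i : continuous ('D_(e_ i) u).
Proof. by case: u1 => _ /(_ i) []. Qed.

Lemma coord_norm_le (x : 'rV[R]_N) i : `|x 0 i| <= `|x|.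
Proof.
rewrite [X in _ <= X]/Num.norm /= mx_normrE.
exact: (le_bigmax _ (fun ij : 'I_1 * 'I_N => `|x ij.1 ij.2|) (0, i)).
Qed.

Lemma support_bounded : exists M : R, 0 < M /\
  forall x, u x != 0 -> forall i, `|x 0 i| < M.
Proof.
have [M [Mr +]] := compact_bounded supp_u.
move=> /(_ (`|M| + 1)); rewrite (le_lt_trans (ler_norm M))// ?ltrDl// => /(_ isT) MP.
exists (`|M| + 2); split=> [|x ux i]; first by rewrite ltr_wpDl.
apply: (le_lt_trans (coord_norm_le x i)).
have /MP/= : closure [set x | u x != 0] x by exact: subset_closure.
by move=> /le_lt_trans; apply; rewrite ltrD2l ltr1n.
Qed.

Lemma partial_eq0 i x : ~ closure [set x | u x != 0] x -> 'D_(e_ i) u x = 0.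
Proof.
move=> nx; have nbx : nbhs x (~` closure [set x | u x != 0]).
  by apply: open_nbhs_nbhs; split=> //; apply: closed_openC; exact: closed_closure.
have u0 y : (~` closure [set x | u x != 0]) y -> u y = 0.
  by move=> ny; apply: contrapT => /eqP uy; apply/ny/subset_closure.
rewrite -(derive_cst (0:R) x (e_ i)); apply: near_eq_derive.
by apply: filterS nbx => y; exact: u0.
Qed.

(** Each partial derivative is continuous and vanishes off the compact support of u; the sum of the
    individual bounds serves for all i at once. *)
Lemma partial_bounded : exists L : R, 0 < L /\
  forall i x, `|'D_(e_ i) u x| <= L.
Proof.
have bnd i : exists L : R, 0 < L /\ forall x, `|'D_(e_ i) u x| <= L.
  have cD : compact ('D_(e_ i) u @` closure [set x | u x != 0]).
    apply: continuous_compact => //.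
    by apply: continuous_subspaceT; exact: C1_partial_continuous.
  have [M [Mr +]] := compact_bounded cD.
  move=> /(_ (`|M| + 1)); rewrite (le_lt_trans (ler_norm M))// ?ltrDl// => /(_ isT) MP.
  exists (`|M| + 1); split=> [|x]; first by rewrite ltr_wpDl.
  have [xS|/partial_eq0 ->] := pselect (closure [set x | u x != 0] x).
    by apply: MP; exists x.
  by rewrite normr0 addr_ge0.
have /choice [L LP] := bnd.
exists (1 + \sum_i L i); split=> [|i x].
  by rewrite ltr_pwDl// sumr_ge0// => i _; case: (LP i) => /ltW.
rewrite (le_trans (proj2 (LP i) x))// (bigD1 i)//= addrCA lerDl.
by rewrite addr_ge0// sumr_ge0// => j _; case: (LP j) => /ltW.
Qed.

Lemma C1_coord_lipschitz L : (forall i x, `|'D_(e_ i) u x| <= L) ->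
  forall i t x, `|u (x + t *: e_ i) - u x| <= `|t| * L.
Proof.
move=> LP i t x.
pose f s := u (x + s *: e_ i).
have df (s : R) : is_derive s 1 f ('D_(e_ i) u (x + s *: e_ i)).
  (* The difference quotients of f at s are those of u at x + s e_i in direction e_i, so the
     derivative carries over without a chain rule. *)
  have E : (fun h : R => h^-1 *: ((f \o shift s) (h *: (1:R)) - f s)) =
      (fun h => h^-1 *: ((u \o shift (x + s *: e_ i)) (h *: e_ i) - u (x + s *: e_ i))).
    apply/funext => h; rewrite /f /shift /=; congr (_ *: (u _ - _)).
    by rewrite (mulr1 h : h *: (1 : R) = h) scalerDl addrCA.
  apply: DeriveDef; rewrite /derivable /derive E; last by [].
  exact: C1_derivable.
have cf : continuous f.
  by move=> s; apply: differentiable_continuous; apply/derivable1_diffP; case: (df s).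
have mvt (a b : R) : a <= b -> `|f b - f a| <= `|b - a| * L.
  move=> ab.
  have [c _ ->] := MVT_segment ab (fun s _ => df s) (continuous_subspaceT cf).
  by rewrite normrM mulrC ler_wpM2l.
have -> : u x = f 0 by rewrite /f scale0r addr0.
have [t0|t0] := leP 0 t; first by have := mvt _ _ t0; rewrite subr0.
by have := mvt _ _ (ltW t0); rewrite distrC sub0r normrN.
Qed.

(** The sequence is |t| times the modulus of the difference quotient with step t/(n+1); t = 0 is
    treated apart because the step must be nonzero. This is the pointwise limit for dominated
    convergence. *)
Lemma C1_difference_quotient i (t : R) x :
  (n.+1%:R * `|u (x + (t / n.+1%:R) *: e_ i) - u x|) @[n --> \oo] -->
  `|t| * `|'D_(e_ i) u x|.
Proof.
have [->|t0] := eqVneq t 0.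
  rewrite (_ : (fun n => _) = cst 0); last first.
    by apply/funext => n; rewrite mul0r scale0r addr0 subrr normr0 mulr0.
  by rewrite normr0 mul0r; exact: cvg_cst.
have h_neq0 n : t / n.+1%:R != 0 by rewrite mulf_neq0// invr_eq0.
have h_cvg : t / n.+1%:R @[n --> \oo] --> 0.
  by rewrite -[X in _ --> X](mulr0 t); apply: cvgM; [exact: cvg_cst|exact: cvg_harmonic].
have /cvgr_dnbhsP /(_ _ (conj h_neq0 h_cvg)) := @C1_derivable i x.
move=> /cvg_norm /(cvgM (cvg_cst `|t|)).
apply: cvg_trans; apply: near_eq_cvg; apply: nearW => n /=.
rewrite /shift /= (addrC (_ *: _)) normrZ mulrA; congr (_ * _).
by rewrite normfV normrM normfV invf_div mulrC divfK ?normr_eq0// ger0_norm.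
Qed.

End C1_compact_support.

(** * Cubes and shifted integrals *)

Section lebesgue_rV_facts.
Variables (R : realType) (N : nat).
Local Notation mu := (lebesgue_rV R N).
Implicit Types (S : set 'rV[R]_N) (p : R).

(** For a > 0 the power is derivable, hence continuous, at a. For a = 0 the threshold e^(1/p) is
    used directly. *)
Lemma powR_cvg p (a_ : nat -> R) (a : R) : 0 < p -> (forall n, 0 <= a_ n) -> 0 <= a ->
  a_ n @[n --> \oo] --> a -> a_ n `^ p @[n --> \oo] --> a `^ p.
Proof.
move=> p0 a_0; rewrite le_eqVlt => /predU1P[<-|a0] cva.
  rewrite powR0 ?gt_eqF//; apply/cvgrPdist_lt => e e0.
  have ep : 0 < e `^ p^-1 by exact: powR_gt0.
  move/cvgrPdist_lt : cva => /(_ _ ep); apply: filterS => n.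
  rewrite !sub0r !normrN ger0_norm// ger0_norm ?powR_ge0// => an.
  have : a_ n `^ p < (e `^ p^-1) `^ p by rewrite gt0_ltr_powR ?nnegrE ?a_0 ?powR_ge0.
  by rewrite -powRrM mulVf ?gt_eqF// powRr1// ltW.
have /derivable1_diffP/differentiable_continuous : derivable (@powR R ^~ p) a 1.
  by apply: derivable_powR; rewrite in_itv/= a0.
by move=> ca; exact: (cvg_comp _ _ cva ca).
Qed.

(** Cubes serve as domains of integration because their measure is explicit and half-sides add when
    points are added. *)
Definition cube (s : R) : set 'rV[R]_N := [set w | forall j, w ord0 j \in `](- s), s[].

Lemma measurable_cube s : measurable (cube s).
Proof. exact: (@measurable_rV_box R N (fun=> [set` `](- s), s[])). Qed.

Lemma cube_measure s : 0 < s -> mu (cube s) = ((2 * s) ^+ N)%:E.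
Proof.
move=> s0.
rewrite (@lebesgue_rV_box R N (fun=> [set` `](- s), s[]))//.
rewrite (eq_bigr (fun=> (2 * s)%:E)); last first.
  move=> _ _; rewrite lebesgue_measure_itv/= lte_fin gtrN//.
  by rewrite -EFinB opprK mulr_natl mulr2n.
by rewrite -[in RHS](card_ord N) -prodr_const prodEFin.
Qed.

Local Open Scope ereal_scope.

Lemma integral_cst_cube (s : R) (c : \bar R) : (0 < s)%R ->
  \int[mu]_(_ in cube s) c = c * ((2 * s) ^+ N)%:E.
Proof.
move=> s0; etransitivity; first exact: (integral_cst _ (measurable_cube s)).
by congr (_ * _); exact: cube_measure.
Qed.

(** Once F is extended by zero off S', the integral over S is bounded by the one over the whole
    space, where the shift is an exact invariance. *)
Lemma ge0_integral_shift_le (S S' : set 'rV[R]_N) (h : 'rV[R]_N) (F : 'rV[R]_N -> \bar R) :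
  measurable S -> measurable S' -> measurable_fun setT F -> (forall x, 0 <= F x) ->
  (forall w, S w -> S' (w + h)%R) ->
  \int[mu]_(w in S) F (w + h)%R <= \int[mu]_(w in S') F w.
Proof.
move=> mS mS' mF F0 SS'.
pose G := F \_ S'.
have mG : measurable_fun setT G by apply/(measurable_restrictT _ _).1 => //; exact: measurable_funTS.
have G0 x : 0 <= G x by apply: erestrict_ge0.
rewrite (eq_integral (fun w : 'rV[R]_N => G (w + h)%R)); last first.
  by move=> w /set_mem wS; rewrite /G /patch mem_set//; exact: SS'.
rewrite [leRHS]integral_mkcond -[leRHS](@ge0_integral_shift_rV _ _ h)//.
apply: ge0_subset_integral => //.
by apply: measurableT_comp => //; exact: measurable_shift_rV.
Qed.

End lebesgue_rV_facts.

(** * The translation estimate *)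

Section truncate_rV.
Variables (R : realType) (N : nat) (h : 'rV[R]_N).

(* The points x + truncate_rV h k, k = 0, ..., N, lead from x to x + h along
   the coordinate axes. *)
Definition truncate_rV (k : nat) : 'rV[R]_N :=
  \row_j (if (j < k)%N then h ord0 j else 0).

Lemma truncate_rV0 : truncate_rV 0 = 0.
Proof. by apply/rowP => j; rewrite !mxE. Qed.

Lemma truncate_rVN : truncate_rV N = h.
Proof. by apply/rowP => j; rewrite mxE ltn_ord. Qed.

Lemma truncate_rVS (k : 'I_N) :
  truncate_rV k.+1 = truncate_rV k + h ord0 k *: basis_rV k.
Proof.
apply/rowP => j; rewrite !mxE /= ltnS leq_eqVlt.
have [->|jk] := eqVneq j k; first by rewrite ltnn eqxx mulr1 add0r.
by rewrite (negbTE (jk : nat_of_ord j != nat_of_ord k)) mulr0 addr0.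
Qed.

Lemma norm_truncate_rV_le (d : R) : (forall j, `|h ord0 j| <= d) ->
  forall k j, `|truncate_rV k ord0 j| <= d.
Proof.
move=> hd k j; rewrite mxE; case: ifP => _; first exact: hd.
by rewrite normr0; exact: le_trans (hd j).
Qed.

End truncate_rV.

Section translation_estimate.
Variables (R : realType) (N : nat) (u : 'rV[R]_N -> R).
Hypothesis u1 : Ck 1 u.
Hypothesis supp_u : compact (closure [set x | u x != 0]).
Variable p : R.
Hypothesis p1 : 1 <= p.

Local Notation e_ i := (basis_rV i : 'rV[R]_N).
Local Notation mu := (lebesgue_rV R N).

Let p0 : 0 < p. Proof. exact: lt_le_trans p1. Qed.

Lemma measurable_C1 : measurable_fun setT u.
Proof. exact: continuous_measurable_rV (C1_continuous u1). Qed.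

Lemma measurable_increment_powR d (T : measurableType d) (f g : T -> 'rV[R]_N) :
  measurable_fun setT f -> measurable_fun setT g ->
  measurable_fun setT (fun x => (`|u (f x) - u (g x)| `^ p)%:E).
Proof.
move=> mf mg; apply/measurable_EFinP.
apply: (measurableT_comp (measurable_powR p)).
apply: (measurableT_comp (@normr_measurable R setT)); apply: measurable_funB.
  exact: (measurableT_comp measurable_C1 mf).
exact: (measurableT_comp measurable_C1 mg).
Qed.

Lemma sume_const n (x : \bar R) : (\sum_(k < n) x = n%:R%:E * x)%E.
Proof.
elim: n => [|n IHn]; first by rewrite big_ord0 mul0e.
by rewrite big_ord_recr/= IHn -natr1 EFinD ge0_muleDl ?mul1e ?lee_fin.
Qed.

(* As n grows, the right-hand side tends to the integral of (|t| |D_i u|)^p by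
   dominated convergence; this replaces an integration along the segment. *)
Lemma increment_subdivision n i (t : R) (S S' : set 'rV[R]_N) :
  measurable S -> measurable S' ->
  (forall w s, S w -> `|s| <= `|t| -> S' (w + s *: e_ i)) ->
  (\int[mu]_(w in S) (`|u (w + t *: e_ i) - u w| `^ p)%:E <=
   \int[mu]_(w in S') ((n.+1%:R * `|u (w + (t / n.+1%:R) *: e_ i) - u w|) `^ p)%:E)%E.
Proof.
move=> mS mS' SS'.
have n0 : (0 : R) < n.+1%:R by rewrite ltr0n.
set h := (t / n.+1%:R) *: e_ i.
pose D (w : 'rV[R]_N) := (`|u (w + h) - u w| `^ p)%:E.
have mD : measurable_fun setT D.
  apply: measurable_increment_powR => //; exact: measurable_shift_rV.
have mDk k : measurable_fun setT (fun w : 'rV[R]_N => D (w + h *+ k)).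
  by apply: measurableT_comp => //; exact: measurable_shift_rV.
pose c : R := n.+1%:R `^ (p - 1).
have c0 : 0 <= c by exact: powR_ge0.
(* The factor (n+1)^p becomes (n+1)^(p-1) times n+1 equal summands, one for each subinterval of the
   segment. *)
have -> : (\int[mu]_(w in S') ((n.+1%:R * `|u (w + h) - u w|) `^ p)%:E =
    c%:E * \sum_(k < n.+1) \int[mu]_(w in S') D w)%E.
  rewrite sume_const muleA -EFinM mulrC mulr_powRB1 ?ltW//.
  rewrite -ge0_integralZl//; last 2 first.
  - exact: measurable_funTS.
  - by move=> w _; rewrite lee_fin powR_ge0.
  by apply: eq_integral => w _; rewrite /D -EFinM powRM ?ler0n.
apply: (@le_trans _ _ (\int[mu]_(w in S) (c%:E * \sum_(k < n.+1) D (w + h *+ k)%R))%E).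
  apply: ge0_le_integral => //.
  - apply: measurable_funTS; apply: measurable_increment_powR => //.
    exact: measurable_shift_rV.
  - apply: measurable_funeM; apply: emeasurable_sum => k.
    exact: measurable_funTS.
  - move=> w _; rewrite sumEFin -EFinM lee_fin.
    have := powR_norm_telescope n.+1 (fun k => u (w + h *+ k)) p1.
    rewrite mulr0n addr0 (_ : h *+ n.+1 = t *: e_ i); last first.
      by rewrite /h -scaler_nat scalerA mulrC divfK ?gt_eqF.
    move=> /le_trans; apply; rewrite le_eqVlt; apply/orP; left; apply/eqP.
    by congr (_ * _); apply: eq_bigr => k _; rewrite mulrSr addrA.
rewrite ge0_integralZl//; last 2 first.
- by apply: emeasurable_sum => k; exact: measurable_funTS.
- by move=> w _; apply: sume_ge0 => k _; rewrite lee_fin powR_ge0.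
rewrite ge0_integral_sum//; last 2 first.
- by move=> k; exact: measurable_funTS.
- by move=> k w _; rewrite lee_fin powR_ge0.
apply: lee_wpmul2l; first by rewrite lee_fin.
apply: lee_sum => k _; apply: ge0_integral_shift_le => //.
  by move=> w; rewrite lee_fin powR_ge0.
(* The k-th shift k t/(n+1) has modulus at most |t|, so it does not leave S'. *)
move=> w Sw; rewrite /h -scaler_nat scalerA; apply: SS' => //.
rewrite mulrCA normrM ler_piMr// normrM normfV !ger0_norm ?ler0n//.
by rewrite ler_pdivrMr// mul1r ler_nat ltnW.
Qed.

(** Let n tend to infinity in [increment_subdivision], whose left-hand side does not depend on n. *)
Lemma coordinate_increment_le i (t : R) (S S' : set 'rV[R]_N) :
  measurable S -> measurable S' ->
  (forall w s, S w -> `|s| <= `|t| -> S' (w + s *: e_ i)) ->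
  (\int[mu]_(w in S) (`|u (w + t *: e_ i) - u w| `^ p)%:E <=
   \int[mu]_(w in S') ((`|t| * `|'D_(e_ i) u w|) `^ p)%:E)%E.
Proof.
move=> mS mS' SS'.
pose F n (w : 'rV[R]_N) := ((n.+1%:R * `|u (w + (t / n.+1%:R) *: e_ i) - u w|) `^ p)%:E.
have [L [L0 LP]] := partial_bounded u1 supp_u.
have [M [M0 MP]] := support_bounded supp_u.
pose Q := @cube R N (M + `|t|).
have Mt : 0 < M + `|t| by rewrite ltr_pwDl.
have mQ : measurable Q by exact: measurable_cube.
(* The dominating function: the scaled increment is at most |t| L by the mean value theorem, and off
   the cube of half-side M + |t| the function u vanishes at both end points. *)
pose G (w : 'rV[R]_N) := ((`|t| * L) `^ p * \1_Q w)%:E.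
have mF n : measurable_fun S' (F n).
  apply: measurable_funTS; apply/measurable_EFinP.
  apply: (measurableT_comp (measurable_powR p)).
  apply: measurable_funM => //; apply: measurableT_comp => //.
  apply: measurable_funB; last exact: measurable_C1.
  exact: (measurableT_comp measurable_C1 (@measurable_shift_rV R N _)).
have cvF : (\int[mu]_(w in S') F n w @[n --> \oo] -->
    \int[mu]_(w in S') ((`|t| * `|'D_(e_ i) u w|) `^ p)%:E)%E.
  have iG : mu.-integrable S' G.
    apply: (@integrableS _ _ _ _ setT) => //; apply/integrableP; split.
      by apply/measurable_EFinP; apply: measurable_funM => //; exact: measurable_indic.
    under eq_integral do rewrite /G EFinM abseM !gee0_abs ?lee_fin ?powR_ge0//.
    rewrite ge0_integralZl//; last 2 first.
    - by apply/measurable_EFinP; exact: measurable_indic.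
    - by rewrite lee_fin powR_ge0.
    rewrite integral_indic// setIT lte_mul_pinfty ?lee_fin ?powR_ge0//.
    by apply: (le_lt_trans _ (ltry ((2 * (M + `|t|)) ^+ N))); rewrite -(cube_measure N Mt).
  have supp_le n w : w \notin Q -> u (w + (t / n.+1%:R) *: e_ i) - u w = 0.
    move=> wQ; have supp0 s : `|s| <= `|t| -> u (w + s *: e_ i) = 0.
      move=> st; apply: contrapT => /eqP us; move/negP : wQ; apply.
      apply/mem_set => j; rewrite in_itv/= -ltr_norml.
      have sd : `|s * (e_ i) ord0 j| <= `|t|.
        apply: le_trans st; rewrite normrM ler_piMr// mxE.
        by case: (_ && _); rewrite ?normr1 ?normr0.
      have wE : (w + s *: e_ i) ord0 j = w ord0 j + s * (e_ i) ord0 j.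
        by rewrite mxE; congr (_ + _); rewrite mxE.
      have := MP _ us j; rewrite wE => uj.
      rewrite -[w ord0 j](addrK (s * (e_ i) ord0 j)).
      by rewrite (le_lt_trans (ler_normB _ _))// ltr_leD.
    have uw : u w = 0 by have := supp0 0; rewrite scale0r addr0 normr0; apply.
    rewrite uw subr0; apply: supp0.
    by rewrite normrM ler_piMr// normfV ger0_norm// invf_le1// ler1n.
  apply: (@dominated_cvg _ _ _ mu S' mS' F _ G) => //.
  - move=> w _; apply: cvg_EFin; first by apply: nearW.
    apply: powR_cvg => //; last exact: C1_difference_quotient.
  - move=> n w _; rewrite /F /G /= ger0_norm ?powR_ge0// lee_fin indicE.
    have [_|wQ] := boolP (w \in Q); last first.
      by rewrite supp_le// normr0 mulr0 powR0 ?gt_eqF// mulr0.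
    rewrite mulr1 ge0_ler_powR ?nnegrE ?(ltW p0) ?mulr_ge0 ?(ltW L0)//.
    rewrite -ler_pdivlMl ?ltr0n//.
    apply: (le_trans (C1_coord_lipschitz u1 LP i _ w)).
    by rewrite normrM normfV (ger0_norm (ler0n R n.+1)) [leRHS]mulrCA mulrA.
rewrite -(cvg_lim _ cvF)//; apply: lime_ge; first by apply/cvg_ex; eexists; exact: cvF.
by apply: nearW => n; exact: increment_subdivision.
Qed.

Local Notation g := (fun x => (enorm (grad u x) `^ p)%:E).

Lemma measurable_grad_powR : measurable_fun setT g.
Proof.
apply/measurable_EFinP; apply: (measurableT_comp (measurable_powR p)).
apply: (measurableT_comp (@continuous_measurable_fun R _ (@sqrt_continuous R))).
apply: measurable_sum => i; apply: measurable_funX.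
under eq_fun do rewrite mxE.
exact: continuous_measurable_rV (C1_partial_continuous u1 (i:=i)).
Qed.

(** Go from w to w + h along the axes. Telescoping costs N^(p-1) and each of the N coordinate
    increments costs d^p, whence (N d)^p. *)
Lemma translation_le (d : R) (h : 'rV[R]_N) (S S' : set 'rV[R]_N) :
  measurable S -> measurable S' -> 0 <= d -> (forall j, `|h ord0 j| <= d) ->
  (forall w (k : 'rV[R]_N), S w -> (forall j, `|k ord0 j| <= d) -> S' (w + k)) ->
  (\int[mu]_(w in S) (`|u (w + h) - u w| `^ p)%:E <=
   ((N%:R * d) `^ p)%:E * \int[mu]_(w in S') g w)%E.
Proof.
move=> mS mS' d0 hd SS'.
pose hk := truncate_rV h.
have hkd k j : `|hk k ord0 j| <= d by exact: norm_truncate_rV_le.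
have hkS (k : 'I_N) : hk k.+1 = hk k + h ord0 k *: e_ k by exact: truncate_rVS.
pose c : R := N%:R `^ (p - 1).
have c0 : 0 <= c by exact: powR_ge0.
have -> : (((N%:R * d) `^ p)%:E * \int[mu]_(w in S') g w =
    c%:E * \sum_(k < N) ((d `^ p)%:E * \int[mu]_(w in S') g w))%E.
  by rewrite sume_const !muleA -!EFinM [c * _]mulrC mulr_powRB1// powRM.
pose D k (w : 'rV[R]_N) := (`|u (w + hk k.+1) - u (w + hk k)| `^ p)%:E.
have mD k : measurable_fun setT (D k).
  by apply: measurable_increment_powR; exact: measurable_shift_rV.
apply: (@le_trans _ _ (\int[mu]_(w in S) (c%:E * \sum_(k < N) D k w)))%E.
  apply: ge0_le_integral => //.
  - apply: measurable_funTS; apply: measurable_increment_powR => //.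
    exact: measurable_shift_rV.
  - apply: measurable_funeM; apply: emeasurable_sum => k.
    exact: measurable_funTS.
  - move=> w _; rewrite sumEFin -EFinM lee_fin.
    have := powR_norm_telescope N (fun k => u (w + hk k)) p1.
    by rewrite /hk truncate_rVN truncate_rV0 addr0.
rewrite ge0_integralZl//; last 2 first.
- by apply: emeasurable_sum => k; exact: measurable_funTS.
- by move=> w _; apply: sume_ge0 => k _; rewrite lee_fin powR_ge0.
rewrite ge0_integral_sum//; last 2 first.
- by move=> k; exact: measurable_funTS.
- by move=> k w _; rewrite lee_fin powR_ge0.
apply: lee_wpmul2l; first by rewrite lee_fin.
apply: lee_sum => k _.
(* Shifting by [hk k] makes the k-th increment start at w, with w in the translate Sk of S. Since
   the k-th coordinate of [hk k] is 0, adding s e_k with |s| <= |h_k| keeps every coordinate of the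
   displacement within d, so S' contains the points reached. *)
pose Sk := (fun w => w - hk k) @^-1` S.
have mSk : measurable Sk.
  by rewrite -[Sk]setTI; exact: (@measurable_shift_rV R N (- hk k)).
pose F (w : 'rV[R]_N) := (`|u (w + h ord0 k *: e_ k) - u w| `^ p)%:E.
apply: (@le_trans _ _ (\int[mu]_(w in Sk) F w)%E).
  under eq_integral => w _ do
    rewrite /D hkS addrA -/(F (w + hk k)).
  apply: ge0_integral_shift_le => //.
  - by apply: measurable_increment_powR => //; exact: measurable_shift_rV.
  - by move=> w; rewrite lee_fin powR_ge0.
  - by move=> w Sw; rewrite /Sk /= addrK.
apply: (@le_trans _ _ (\int[mu]_(w in S') ((`|h ord0 k| * `|'D_(e_ k) u w|) `^ p)%:E)%E).
  apply: coordinate_increment_le => // w s Sw sh.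
  rewrite -(subrK (hk k) w) -addrA; apply: SS' => // j.
  rewrite !mxE; have [->|jk] := eqVneq j k.
    by rewrite ltnn add0r mulr1 (le_trans sh).
  by rewrite andbF mulr0 addr0; case: ifP => _; [exact: hd|rewrite normr0].
have mg : measurable_fun S' g by apply: measurable_funTS; exact: measurable_grad_powR.
rewrite -(ge0_integralZl mu mS' mg); last 2 first.
- by move=> w _; rewrite lee_fin powR_ge0.
- by rewrite lee_fin powR_ge0.
apply: ge0_le_integral => //.
- apply/measurable_funTS/measurable_EFinP.
  apply: (measurableT_comp (measurable_powR p)); apply: measurable_funM => //.
  apply: (measurableT_comp (@normr_measurable R setT)).
  exact: continuous_measurable_rV (C1_partial_continuous u1 (i:=k)).
- exact: measurable_funeM.
move=> w _; rewrite -EFinM lee_fin -powRM ?sqrtr_ge0//.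
rewrite ge0_ler_powR ?nnegrE ?(ltW p0) ?mulr_ge0 ?sqrtr_ge0//.
rewrite ler_pM// /enorm -sqrtr_sqr ler_sqrt; last first.
  by rewrite sumr_ge0// => i _; rewrite sqr_ge0.
by rewrite (bigD1 k)//= mxE lerDl sumr_ge0// => i _; rewrite sqr_ge0.
Qed.

Lemma C1_lipschitz (L d : R) (x h : 'rV[R]_N) :
  (forall i x, `|'D_(e_ i) u x| <= L) -> 0 <= L -> (forall j, `|h ord0 j| <= d) ->
  `|u (x + h) - u x| <= N%:R * d * L.
Proof.
move=> LP L0 hd.
have -> : u (x + h) - u x = \sum_(0 <= k < N) (u (x + truncate_rV h k.+1) - u (x + truncate_rV h k)).
  by rewrite telescope_sumr// truncate_rVN truncate_rV0 addr0.
rewrite big_mkord (le_trans (ler_norm_sum _ _ _))//.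
rewrite (@le_trans _ _ (\sum_(k < N) d * L))//; last first.
  by rewrite sumr_const card_ord -[leLHS]mulr_natl mulrA.
apply: ler_sum => k _; rewrite truncate_rVS addrA.
by rewrite (le_trans (C1_coord_lipschitz u1 LP _ _ _))// ler_wpM2r.
Qed.

End translation_estimate.

(** * Tonelli's theorem on measurable rectangles *)

Section tonelli.
Context d1 d2 (T1 : measurableType d1) (T2 : measurableType d2) (R : realType).
Variables (m1 : {sigma_finite_measure set T1 -> \bar R})
  (m2 : {sigma_finite_measure set T2 -> \bar R}).
Local Open Scope ereal_scope.

Lemma measurable_integral_section (B : set T2) (F : T1 * T2 -> \bar R) :
  measurable B -> measurable_fun setT F -> (forall z, 0 <= F z) ->
  measurable_fun setT (fun x => \int[m2]_(y in B) F (x, y)).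
Proof.
move=> mB mF F0.
pose G := F \_ (setT `*` B).
have mG : measurable_fun setT G.
  by apply/(measurable_restrictT _ _).1; [exact: measurableX|exact: measurable_funTS].
have G0 z : 0 <= G z by apply: erestrict_ge0.
have := @measurable_fun_fubini_tonelli_F _ _ _ _ _ m2 G mG G0.
apply: eq_measurable_fun => x _; rewrite /fubini_F [RHS]integral_mkcond.
apply: eq_integral => y _; rewrite /G /patch.
by rewrite in_setX in_setT.
Qed.

Lemma measurable_integral_section2 (A : set T1) (F : T1 * T2 -> \bar R) :
  measurable A -> measurable_fun setT F -> (forall z, 0 <= F z) ->
  measurable_fun setT (fun y => \int[m1]_(x in A) F (x, y)).
Proof.
move=> mA mF F0.
pose G := F \_ (A `*` setT).
have mG : measurable_fun setT G.
  by apply/(measurable_restrictT _ _).1; [exact: measurableX|exact: measurable_funTS].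
have G0 z : 0 <= G z by apply: erestrict_ge0.
have := @measurable_fun_fubini_tonelli_G _ _ _ _ _ m1 G mG G0.
apply: eq_measurable_fun => y _; rewrite /fubini_G [RHS]integral_mkcond.
apply: eq_integral => x _; rewrite /G /patch.
by rewrite in_setX in_setT andbT.
Qed.

Lemma tonelli_set (A : set T1) (B : set T2) (F : T1 * T2 -> \bar R) :
  measurable A -> measurable B -> measurable_fun setT F -> (forall z, 0 <= F z) ->
  \int[m1]_(x in A) \int[m2]_(y in B) F (x, y) =
  \int[m2]_(y in B) \int[m1]_(x in A) F (x, y).
Proof.
move=> mA mB mF F0.
pose G := F \_ (A `*` B).
have mG : measurable_fun setT G.
  by apply/(measurable_restrictT _ _).1; [exact: measurableX|exact: measurable_funTS].
have G0 z : 0 <= G z by apply: erestrict_ge0.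
have := @fubini_tonelli _ _ _ _ _ m1 m2 G mG G0.
rewrite /fubini_F /fubini_G => E.
rewrite integral_mkcond [RHS]integral_mkcond; etransitivity; last (etransitivity; first exact: E).
  apply: eq_integral => x _; rewrite [LHS]/patch; case: ifPn => xA.
    rewrite integral_mkcond; apply: eq_integral => y _.
    by rewrite /G /patch in_setX xA.
  by rewrite integral0_eq// => y _; rewrite /G /patch in_setX (negbTE xA).
apply: eq_integral => y _; rewrite [RHS]/patch; case: ifPn => yB.
  rewrite [RHS]integral_mkcond; apply: eq_integral => x _.
  by rewrite /G /patch in_setX yB andbT.
by rewrite integral0_eq// => x _; rewrite /G /patch in_setX (negbTE yB) andbF.
Qed.

End tonelli.

(** * Translation estimates averaged over the shift *)

Section translation_average.
Variables (R : realType) (N : nat) (u : 'rV[R]_N -> R).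
Hypothesis u1 : Ck 1 u.
Hypothesis supp_u : compact (closure [set x | u x != 0]).
Variable p : R.
Hypothesis p1 : 1 <= p.
Local Notation mu := (lebesgue_rV R N).
Local Notation g := (fun x => (enorm (grad u x) `^ p)%:E).
Local Open Scope ereal_scope.

Lemma measurable_increment_pair (x : 'rV[R]_N) :
  measurable_fun setT (fun z : 'rV[R]_N * 'rV[R]_N =>
    (`|u (x + z.1 + z.2) - u (x + z.1)| `^ p)%:E).
Proof.
have mx : measurable_fun setT (fun z : 'rV[R]_N * 'rV[R]_N => x + z.1)%R.
  by apply: measurable_funD_rV => //; exact: measurable_cst.
apply: measurable_increment_powR => //.
by apply: measurable_funD_rV => //; exact: measurable_snd.
Qed.

Lemma translation_cube_le (x h : 'rV[R]_N) (a d b : R) : (0 <= d)%R -> (a + d <= b)%R ->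
  (forall j, `|h ord0 j| <= d)%R ->
  \int[mu]_(w in cube a) (`|u (x + w + h) - u (x + w)| `^ p)%:E <=
  ((N%:R * d) `^ p)%:E * \int[mu]_(w in cube b) g (x + w)%R.
Proof.
move=> d0 adb hd.
have mc c : measurable ((fun w : 'rV[R]_N => (w + - x)%R) @^-1` cube c).
  rewrite -[X in measurable X]setTI; apply: (@measurable_shift_rV R N (- x)%R) => //.
  exact: measurable_cube.
apply: (@le_trans _ _ (\int[mu]_(w in (fun w : 'rV[R]_N => (w + - x)%R) @^-1` cube a)
   (`|u (w + h) - u w| `^ p)%:E)).
  under eq_integral => w _ do rewrite (addrC x w).
  apply: (@ge0_integral_shift_le _ _ _ _ x (fun w => (`|u (w + h)%R - u w| `^ p)%:E)) => //.
  - exact: measurable_cube.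
  - by apply: measurable_increment_powR => //; exact: measurable_shift_rV.
  - by move=> w aw; rewrite /= addrK.
have := translation_le u1 supp_u p1 (mc a) (mc b) d0 hd.
move=> /(_ _)/le_trans; apply.
  move=> w k /= aw kd j.
  have := aw j; rewrite !in_itv/= -!ltr_norml => awj.
  have -> : ((w + k - x) ord0 j = (w - x) ord0 j + k ord0 j)%R.
    by rewrite addrAC mxE.
  by rewrite (le_lt_trans (ler_normD _ _))// (lt_le_trans _ adb)// ltr_leD.
apply: lee_wpmul2l; first by rewrite lee_fin powR_ge0.
have -> : \int[mu]_(w in (fun w : 'rV[R]_N => (w + - x)%R) @^-1` cube b) g w =
   \int[mu]_(w in (fun w : 'rV[R]_N => (w + - x)%R) @^-1` cube b) g (x + (w + - x))%R.
  by apply: eq_integral => w _; rewrite addrC subrK.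
apply: (@ge0_integral_shift_le _ _ _ _ (- x)%R (fun w => g (x + w)%R)) => //.
- exact: measurable_cube.
- apply: (measurableT_comp (measurable_grad_powR u1 p)).
  by apply: measurable_funD_rV => //; exact: measurable_cst.
- by move=> w; rewrite lee_fin powR_ge0.
Qed.

Lemma translation_average_le (x : 'rV[R]_N) (B : set 'rV[R]_N) (a d b : R) :
  measurable B -> (0 <= d)%R -> (a + d <= b)%R ->
  (forall k, B k -> forall j, `|k ord0 j| <= d)%R ->
  \int[mu]_(w in cube a) \int[mu]_(k in B) (`|u (x + w + k) - u (x + w)| `^ p)%:E <=
  ((N%:R * d) `^ p)%:E * \int[mu]_(w in cube b) g (x + w)%R * mu B.
Proof.
move=> mB d0 adb Bd.
rewrite (@tonelli_set _ _ _ _ R mu mu (cube a) B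
  (fun z => (`|u (x + z.1 + z.2) - u (x + z.1)| `^ p)%:E))//.
- rewrite -integral_cst//; apply: ge0_le_integral => //.
  + by move=> k _; apply: integral_ge0 => w _; rewrite lee_fin powR_ge0.
  + apply: measurable_funTS.
    apply: (@measurable_integral_section2 _ _ _ _ R mu (cube a)
      (fun z => (`|u (x + z.1 + z.2) - u (x + z.1)| `^ p)%:E)).
    * exact: measurable_cube.
    * exact: measurable_increment_pair.
    * by move=> z; rewrite lee_fin powR_ge0.
  + by move=> k Bk; apply: translation_cube_le => // j; exact: Bd.
- exact: measurable_cube.
- exact: measurable_increment_pair.
Qed.

(** If u(x + h) = 0, the increment from x to x + h has modulus |u(x)|; hence its p-th power
    integrated over h in B is at least kappa |u(x)|^p. Integrating in x and exchanging the integrals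
    leaves [translation_le] for each fixed h. *)
Lemma poincare_zero_density (B : set 'rV[R]_N) (kappa d : R) :
  measurable B -> (0 <= d)%R -> (0 <= kappa)%R ->
  (forall k, B k -> forall j, `|k ord0 j| <= d)%R ->
  (forall x, u x != 0%R -> kappa%:E <= mu (B `&` [set h | u (x + h)%R = 0%R])) ->
  kappa%:E * \int[mu]_x (`|u x| `^ p)%:E <=
  ((N%:R * d) `^ p)%:E * \int[mu]_x g x * mu B.
Proof.
move=> mB d0 k0 Bd uB.
have p0 : (0 < p)%R by exact: lt_le_trans p1.
have mu_ : measurable_fun setT (fun x => (`|u x| `^ p)%:E).
  apply/measurable_EFinP; apply: (measurableT_comp (measurable_powR p)).
  by apply: (measurableT_comp (@normr_measurable R setT)); exact: measurable_C1.
pose F (z : 'rV[R]_N * 'rV[R]_N) := (`|u (z.1 + z.2) - u z.1| `^ p)%:E.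
have mF : measurable_fun setT F.
  by apply: measurable_increment_powR => //; exact: measurable_funD_rV.
have F0 z : 0 <= F z by rewrite lee_fin powR_ge0.
apply: (@le_trans _ _ (\int[mu]_x \int[mu]_(h in B) F (x, h))).
  rewrite -(ge0_integralZl mu measurableT mu_); last 2 first.
  - by move=> x _; rewrite lee_fin powR_ge0.
  - by rewrite lee_fin.
  apply: ge0_le_integral => //.
  - by move=> x _; rewrite mule_ge0// lee_fin powR_ge0.
  - exact: measurable_funeM.
  - exact: measurable_integral_section.
  move=> x _; have [ux|ux] := eqVneq (u x) 0%R.
    by rewrite ux normr0 powR0 ?gt_eqF// mule0; exact: integral_ge0.
  set A := B `&` [set h | u (x + h)%R = 0%R].
  have mA : measurable A.
    apply: measurableI => //.
    have /(_ measurableT [set 0%R]) : measurable_fun setT (fun h : 'rV[R]_N => u (x + h)%R).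
      apply: (measurableT_comp (measurable_C1 u1)).
      by apply: measurable_funD_rV => //; exact: measurable_cst.
    by rewrite setTI; apply; exact: measurable_set1.
  apply: (@le_trans _ _ (\int[mu]_(h in A) F (x, h))).
    rewrite (eq_integral (fun=> (`|u x| `^ p)%:E)); last first.
      by move=> h /set_mem[_ /= uxh]; rewrite /F /= uxh sub0r normrN.
    by rewrite integral_cst// muleC lee_wpmul2l ?lee_fin ?powR_ge0//; exact: uB.
  apply: ge0_subset_integral => //; last exact: subIsetl.
  by apply: measurable_funTS; exact: (measurableT_comp mF (pair1_measurable _)).
rewrite tonelli_set// -integral_cst//; apply: ge0_le_integral => //.
- by move=> k _; apply: integral_ge0.
- by apply: measurable_funTS; exact: measurable_integral_section2.
- move=> k Bk; apply: (translation_le u1 supp_u p1) => // j; exact: Bd.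
Qed.

End translation_average.

(** Iterating n times gives e(r) <= K dl(r) + A^n e(r/2^n), where K solves K = A q K + c. The last
    term is at most C (A b)^n and tends to 0. *)
Lemma geometric_iteration (R : realType) (e dl : R -> R) (r A q c b C : R) :
  0 < r -> 0 <= c -> (forall s, 0 < s -> 0 <= dl s) -> 0 <= A -> A * q < 1 -> 0 <= b -> A * b < 1 ->
  (forall s, 0 < s <= r -> e s <= A * e (s / 2) + c * dl s) ->
  (forall s, 0 < s -> dl (s / 2) = q * dl s) ->
  (forall n, e (r / 2 ^+ n) <= C * b ^+ n) ->
  e r <= c / (1 - A * q) * dl r.
Proof.
move=> r0 c0 dl0 A0 Aq b0 Ab es dls eC.
set K := c / (1 - A * q).
have KE : A * K * q + c = K.
  by rewrite /K; field; rewrite subr_eq0 gt_eqF.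
have eA n s : 0 < s <= r -> e s <= K * dl s + A ^+ n * e (s / 2 ^+ n).
  elim: n s => [|n IHn] s /andP[s0 sr].
    by rewrite expr0 mul1r divr1 lerDr mulr_ge0 ?dl0// divr_ge0// subr_ge0 ltW.
  have s2 : 0 < s / 2 <= r.
    by rewrite divr_gt0//= (le_trans _ sr)// ler_pdivrMr// ler_peMr ?ltW// ltr1n.
  apply: (le_trans (es s _)); first by rewrite s0.
  apply: (@le_trans _ _ (A * (K * dl (s / 2) + A ^+ n * e (s / 2 / 2 ^+ n)) + c * dl s)).
    by rewrite lerD2r ler_wpM2l// IHn.
  rewrite dls// le_eqVlt; apply/orP; left; apply/eqP.
  have -> : s / 2 ^+ n.+1 = s / 2 / 2 ^+ n by rewrite exprS invfM mulrA.
  by rewrite exprS -[X in _ = X * dl s + _]KE; ring.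
have lim0 : K * dl r + C * (A * b) ^+ n @[n --> \oo] --> K * dl r.
  rewrite -[X in _ --> X]addr0 -[X in _ --> _ + X](mulr0 C).
  apply: cvgD; first exact: cvg_cst.
  apply: cvgM; first exact: cvg_cst.
  by apply: cvg_expr; rewrite ger0_norm ?mulr_ge0.
rewrite -(cvg_lim _ lim0)//; apply: limr_ge; first by apply/cvg_ex; eexists; exact: lim0.
apply: nearW => n; apply: (le_trans (eA n r _)); first by rewrite r0 lexx.
by rewrite lerD2l exprMn mulrCA ler_wpM2l// exprn_ge0.
Qed.

(** * The case p > N *)

Section morrey.
Variables (R : realType) (N : nat) (u : 'rV[R]_N -> R).
Hypothesis u1 : Ck 1 u.
Hypothesis supp_u : compact (closure [set x | u x != 0]).
Variable p : R.
Hypothesis p1 : 1 <= p.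
Local Notation mu := (lebesgue_rV R N).
Local Notation g := (fun x => (enorm (grad u x) `^ p)%:E).
Local Open Scope ereal_scope.

Let p0 : (0 < p)%R. Proof. exact: lt_le_trans p1. Qed.

Definition osc_powR (x : 'rV[R]_N) (s : R) : \bar R :=
  \int[mu]_(w in cube s) (`|u (x + w) - u x| `^ p)%:E.

Let measurable_addl (x : 'rV[R]_N) : measurable_fun setT (fun w : 'rV[R]_N => x + w)%R.
Proof. by apply: measurable_funD_rV => //; exact: measurable_cst. Qed.

(* Average |u(x+h) - u(x)| <= |u(x+v) - u(x)| + |u(x+h) - u(x+v)| over h in the
   cube of half-side s and v in the one of half-side s/2. *)
Lemma osc_powR_halving (x : 'rV[R]_N) (s t : R) : (0 < s)%R -> (0 < t < 1)%R ->
  (s ^+ N)%:E * osc_powR x s <=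
  ((1 - t) `^ (1 - p) * (2 * s) ^+ N)%:E * osc_powR x (s / 2) +
  (t `^ (1 - p) * (N%:R * (2 * s)) `^ p * (4 * s) ^+ N)%:E *
    \int[mu]_(w in cube (3 * s)) g (x + w)%R.
Proof.
move=> s0 t01.
set A := ((1 - t) `^ (1 - p))%R; set B := (t `^ (1 - p))%R.
have A0 : (0 <= A)%R by exact: powR_ge0.
have B0 : (0 <= B)%R by exact: powR_ge0.
have s20 : (0 < s / 2)%R by rewrite divr_gt0.
have mQ := @measurable_cube R N.
pose D (w : 'rV[R]_N) := (`|u (x + w) - u x| `^ p)%:E.
pose F (z : 'rV[R]_N * 'rV[R]_N) := (`|u (x + z.1 + z.2) - u (x + z.1)| `^ p)%:E.
have mD : measurable_fun setT D.
  by apply: measurable_increment_powR => //; exact: measurable_cst.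
have mF : measurable_fun setT F by exact: measurable_increment_pair.
have D0 w : 0 <= D w by rewrite lee_fin powR_ge0.
have F0 z : 0 <= F z by rewrite lee_fin powR_ge0.
pose J v := \int[mu]_(k in cube (2 * s)) F (v, k).
have mJ : measurable_fun setT J by exact: measurable_integral_section.
have J0 v : 0 <= J v by exact: integral_ge0.
have step v : cube (s / 2) v ->
    osc_powR x s <= (A * (2 * s) ^+ N)%:E * D v + B%:E * J v.
  move=> vs.
  pose E (h : 'rV[R]_N) := (`|u (x + h) - u (x + v)| `^ p)%:E.
  have mE : measurable_fun setT E.
    by apply: measurable_increment_powR => //; exact: measurable_cst.
  have E0 w : 0 <= E w by rewrite lee_fin powR_ge0.
  apply: (@le_trans _ _ (\int[mu]_(h in cube s) (A%:E * D v + B%:E * E h))).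
    apply: ge0_le_integral => //.
    - exact: measurable_funTS.
    - apply: measurable_funTS; apply: emeasurable_funD; first exact: measurable_cst.
      exact: measurable_funeM.
    move=> h _; rewrite lee_fin.
    apply: le_trans (powRD_le p1 t01 (normr_ge0 _) (normr_ge0 _)).
    rewrite ge0_ler_powR ?nnegrE ?(ltW p0) ?addr_ge0//.
    have -> : (u (x + h) - u x = (u (x + v) - u x) + (u (x + h) - u (x + v)))%R by ring.
    exact: ler_normD.
  rewrite ge0_integralD//; last first.
  - by apply: measurable_funTS; exact: measurable_funeM.
  - by move=> h _; rewrite mule_ge0.
  - by move=> h _; rewrite mule_ge0.
  rewrite integral_cst_cube// muleAC -EFinM; apply: leeD => //.
  have mEs : measurable_fun (cube s) E by exact: measurable_funTS.
  have B0' : 0 <= B%:E by rewrite lee_fin.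
  rewrite (ge0_integralZl mu (mQ s) mEs (fun w _ => E0 w) B0').
  apply: (lee_wpmul2l B0').
  (* Substitute k = h - v, whose coordinates stay below s + s/2 < 2s. *)
  rewrite (eq_integral (fun h : 'rV[R]_N => F (v, h - v)%R)); last first.
    by move=> h _; rewrite /F /E /= -!addrA [(v + _)%R]addrC subrK.
  apply: (ge0_integral_shift_le (h := (- v)%R) (F := fun k => F (v, k))) => //.
    by apply: (measurableT_comp mF); exact: pair1_measurable.
  move=> h hs j; have := hs j; have := vs j; rewrite /= !in_itv/= -!ltr_norml => vj hj.
  rewrite mxE (le_lt_trans (ler_normD _ _))// mxE normrN.
  by rewrite mulr_natl mulr2n ltrD// (lt_trans vj)// ltr_pdivrMr// ltr_pMr// ltr1n.
have As0 : (0 <= A * (2 * s) ^+ N)%R by rewrite mulr_ge0// exprn_ge0// mulr_ge0// ltW.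
apply: (@le_trans _ _ (\int[mu]_(v in cube (s / 2)) ((A * (2 * s) ^+ N)%:E * D v + B%:E * J v))).
  (* The cube of half-side s/2 has measure s^N, which accounts for the factor on the left. *)
  have -> : (s ^+ N)%:E * osc_powR x s = \int[mu]_(v in cube (s / 2)) osc_powR x s.
    rewrite integral_cst_cube// muleC; congr (_ * (_ ^+ N)%:E).
    by rewrite mulrC divfK.
  apply: ge0_le_integral => //.
  - by move=> v _; exact: integral_ge0.
  - apply: measurable_funTS; apply: emeasurable_funD; exact: measurable_funeM.
rewrite ge0_integralD//; last 4 first.
- by move=> v _; rewrite mule_ge0.
- by apply: measurable_funTS; exact: measurable_funeM.
- by move=> v _; rewrite mule_ge0.
- by apply: measurable_funTS; exact: measurable_funeM.
rewrite !ge0_integralZl//; last 2 first.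
- exact: measurable_funTS.
- exact: measurable_funTS.
apply: leeD => //.
rewrite -mulrA EFinM -muleA; apply: lee_wpmul2l => //.
have s2 : (0 < 2 * s)%R by rewrite mulr_gt0.
(* Starting points of half-side s/2 and shifts of half-side 2s stay in the cube of half-side 3s. *)
have := @translation_average_le _ _ u u1 supp_u p p1 x (cube (2 * s)) (s / 2) (2 * s) (3 * s).
move=> /(_ (mQ _) (ltW s2)) H.
have cubeE : mu (cube (2 * s)) = ((4 * s) ^+ N)%:E.
  by rewrite cube_measure//; congr (_ ^+ N)%:E; rewrite mulrA; congr (_ * _)%R; rewrite -natrM.
apply: (le_trans (H _ _)).
- lra.
- by move=> k ks j; have := ks j; rewrite in_itv/= -ltr_norml => /ltW.
- by rewrite EFinM -cubeE muleAC.
Qed.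

Lemma osc_powR_ge0 x s : 0 <= osc_powR x s.
Proof. by apply: integral_ge0 => w _; rewrite lee_fin powR_ge0. Qed.

(** A crude bound of order s^(p+N) whose constant depends on u. It makes [osc_powR] finite and sends
    the remainder of the iteration to 0, so the constant does not survive in the result. *)
Lemma osc_powR_lipschitz : exists2 C : R, (0 <= C)%R &
  forall x s, (0 < s)%R -> osc_powR x s <= ((C * s) `^ p * (2 * s) ^+ N)%:E.
Proof.
have [L [L0 LP]] := partial_bounded u1 supp_u.
exists (N%:R * L)%R => [|x s s0]; first by rewrite mulr_ge0// ltW.
rewrite EFinM -integral_cst_cube//; apply: ge0_le_integral => //.
- exact: measurable_cube.
- by apply: measurable_funTS; apply: measurable_increment_powR => //; exact: measurable_cst.
move=> w ws; rewrite lee_fin ge0_ler_powR ?nnegrE ?(ltW p0)//.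
  by rewrite !mulr_ge0// ltW.
rewrite mulrAC; apply: (C1_lipschitz u1) => //; first exact: ltW.
by move=> j; have := ws j; rewrite in_itv/= -ltr_norml => /ltW.
Qed.

Variable t : R.
Hypothesis t01 : (0 < t < 1)%R.
Let A : R := (1 - t) `^ (1 - p).
(** q = 2^(N-p) is the factor by which s^p / s^N changes when s is halved; A q < 1 makes the
    iteration converge. *)
Let q : R := 2 ^+ N / 2 `^ p.
Hypothesis Aq : (A * q < 1)%R.
Hypothesis N0 : (0 < N)%N.

(** The sum c/(1 - A q) of the geometric series, where c is the gradient coefficient of
    [osc_powR_halving] stripped of its factor s^(p+N). *)
Definition morrey_constant : R :=
  t `^ (1 - p) * (2 * N%:R) `^ p * 4 ^+ N / (1 - A * q).

Let two_powR_gt0 : (0 < (2 : R) `^ p)%R. Proof. by rewrite powR_gt0. Qed.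

Lemma morrey_constant_gt0 : (0 < morrey_constant)%R.
Proof.
rewrite divr_gt0 ?subr_gt0// !mulr_gt0 ?exprn_gt0// powR_gt0//.
  by case/andP : t01.
by rewrite mulr_gt0// ltr0n.
Qed.

(** [geometric_iteration] for the normalised oscillation [osc_powR x s] / s^N. The gradient integral
    over the largest cube bounds those at all scales s <= r and enters c as a constant; if it is
    infinite there is nothing to prove. *)
Lemma osc_powR_le (x : 'rV[R]_N) (r : R) : (0 < r)%R ->
  osc_powR x r <= (morrey_constant * r `^ p)%:E * \int[mu]_(w in cube (3 * r)) g (x + w)%R.
Proof.
move=> r0; set G := \int[mu]_(w in _) _.
have G0 : 0 <= G by apply: integral_ge0 => w _; rewrite lee_fin powR_ge0.
have [->|Gy] := eqVneq G +oo.
  by rewrite gt0_muley ?leey// lte_fin mulr_gt0 ?powR_gt0 ?morrey_constant_gt0.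
have Gfin : G \is a fin_num by rewrite ge0_fin_numE// ltey.
set gamma := fine G.
have gamma0 : (0 <= gamma)%R by exact: fine_ge0.
have [C C0 oscC] := osc_powR_lipschitz.
have oscfin s : (0 < s)%R -> osc_powR x s \is a fin_num.
  move=> s0; rewrite ge0_fin_numE ?osc_powR_ge0//.
  by rewrite (le_lt_trans (oscC x s s0))// ltry.
pose i s := fine (osc_powR x s).
have i_halving s : (0 < s <= r)%R -> (s ^+ N * i s <= A * (2 * s) ^+ N * i (s / 2) +
    t `^ (1 - p) * (N%:R * (2 * s)) `^ p * (4 * s) ^+ N * gamma)%R.
  move=> /andP[s0 sr].
  have s20 : (0 < s / 2)%R by rewrite divr_gt0.
  have := osc_powR_halving x s0 t01; rewrite -(fineK (oscfin _ s0)) -(fineK (oscfin _ s20)).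
  rewrite -/(i s) -/(i (s / 2)%R) -lee_fin => /le_trans; apply.
  rewrite EFinD; apply: leeD; first exact: lexx.
  rewrite [leRHS]EFinM /gamma (fineK Gfin); apply: lee_wpmul2l.
    by rewrite lee_fin mulr_ge0 ?exprn_ge0 ?mulr_ge0 ?powR_ge0 ?(ltW s0).
  apply: ge0_subset_integral => //; [exact: measurable_cube|exact: measurable_cube| | |].
  - by apply: measurable_funTS; exact: (measurableT_comp (measurable_grad_powR u1 p)).
  - by move=> w _; rewrite lee_fin powR_ge0.
  - move=> w ws j; have := ws j; rewrite !in_itv/= -!ltr_norml => /lt_le_trans; apply.
    by rewrite ler_wpM2l.
pose c : R := (t `^ (1 - p) * (2 * N%:R) `^ p * 4 ^+ N * gamma)%R.
have A0 : (0 <= A)%R by exact: powR_ge0.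
have q0 : (0 <= q)%R by rewrite divr_ge0 ?powR_ge0 ?exprn_ge0.
have half : (i r / r ^+ N <= c / (1 - A * q) * (r `^ p / r ^+ N))%R.
  apply: (@geometric_iteration R (fun s => i s / s ^+ N)%R (fun s => s `^ p / s ^+ N)%R r A q c
    (2 `^ p)^-1%R ((C * r) `^ p * 2 ^+ N)%R) => //.
  - by rewrite !mulr_ge0 ?powR_ge0 ?exprn_ge0.
  - by move=> s s0; rewrite divr_ge0 ?powR_ge0 ?exprn_ge0// ltW.
  (* Here b = 2^(-p) is at most q because 2^N >= 1. *)
  - apply: le_lt_trans Aq; rewrite ler_wpM2l// ler_peMl ?invr_ge0 ?(ltW two_powR_gt0)//.
    by rewrite exprn_ege1// ler1n.
  - move=> s /[dup] /andP[s0 _] /i_halving.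
    have S0 : (0 < s ^+ N)%R by rewrite exprn_gt0.
    have -> : (N%:R * (2 * s) = (2 * N%:R) * s)%R by ring.
    rewrite (powRM p (x := 2 * N%:R)%R) ?mulr_ge0 ?(ltW s0)// !exprMn exprVn => H.
    rewrite ler_pdivrMr// -(ler_pM2l S0); apply: (le_trans H).
    rewrite le_eqVlt; apply/orP; left; apply/eqP; rewrite /c.
    by field; rewrite ?gt_eqF ?exprn_gt0.
  - move=> s s0; rewrite powRM ?invr_ge0 ?(ltW s0)// exprMn exprVn /q.
    rewrite powRV//.
    by field; rewrite ?gt_eqF ?exprn_gt0 ?powR_gt0.
  - move=> n; have s0 : (0 < r / 2 ^+ n)%R by rewrite divr_gt0// exprn_gt0.
    rewrite ler_pdivrMr ?exprn_gt0//.
    have := oscC x _ s0; rewrite -(fineK (oscfin _ s0)) lee_fin => /le_trans; apply.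
    rewrite (mulrA C) (powRM p (x := (C * r)%R)) ?mulr_ge0 ?invr_ge0 ?exprn_ge0 ?(ltW r0)//.
    rewrite powRV ?exprn_ge0// powRX// (exprMn N 2%R) (exprVn (2 `^ p)%R).
    by rewrite le_eqVlt; apply/orP; left; apply/eqP; ring.
rewrite -(fineK Gfin) -/gamma -(fineK (oscfin _ r0)) -EFinM lee_fin -/(i r).
have S0 : (0 < r ^+ N)%R by rewrite exprn_gt0.
move: half; rewrite mulrA ler_pM2r ?invr_gt0// => /le_trans; apply.
by rewrite le_eqVlt /c /morrey_constant; apply/orP; left; apply/eqP; ring.
Qed.

(** 3^(p-1) is the telescoping cost of three increments: two oscillations cost [morrey_constant]
    each and a translation costs N^p. *)
Definition morrey_pointwise_constant : R :=
  3%:R `^ (p - 1) * (2 * morrey_constant + N%:R `^ p).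

Lemma morrey_pointwise_constant_gt0 : (0 < morrey_pointwise_constant)%R.
Proof.
by rewrite mulr_gt0 ?powR_gt0// ltr_pwDl ?powR_ge0// mulr_gt0// morrey_constant_gt0.
Qed.

(** Follow the chain x, x + w, x + w + h, x + h and integrate over w in cube r. The outer increments
    are oscillations around x and x + h, the middle one is a translation by h, and the total is
    |u(x)| in modulus. *)
Lemma morrey_pointwise (x h : 'rV[R]_N) (r : R) : (0 < r)%R -> (forall j, `|h ord0 j| <= r)%R ->
  u (x + h)%R = 0%R ->
  ((2 * r) ^+ N)%:E * (`|u x| `^ p)%:E <=
  (morrey_pointwise_constant * r `^ p)%:E * \int[mu]_(w in cube (4 * r)) g (x + w)%R.
Proof.
move=> r0 hr uxh; set G := \int[mu]_(w in _) _.
have K0 := ltW morrey_constant_gt0.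
have rp0 : (0 <= r `^ p)%R by exact: powR_ge0.
have G0 : 0 <= G by apply: integral_ge0 => w _; rewrite lee_fin powR_ge0.
have mQ := @measurable_cube R N.
have mg (y : 'rV[R]_N) : measurable_fun setT (fun w : 'rV[R]_N => g (y + w)%R).
  exact: (measurableT_comp (measurable_grad_powR u1 p)).
pose D0 (w : 'rV[R]_N) := (`|u (x + w) - u x| `^ p)%:E.
pose D1 (w : 'rV[R]_N) := (`|u (x + w + h) - u (x + w)| `^ p)%:E.
pose D2 (w : 'rV[R]_N) := (`|u (x + h + w) - u (x + h)| `^ p)%:E.
have mD0 : measurable_fun (cube r) D0.
  by apply: measurable_funTS; apply: measurable_increment_powR => //; exact: measurable_cst.
have mD2 : measurable_fun (cube r) D2.
  by apply: measurable_funTS; apply: measurable_increment_powR => //; exact: measurable_cst.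
have mD1 : measurable_fun (cube r) D1.
  apply: measurable_funTS; apply: measurable_increment_powR => //.
  by apply: measurable_funD_rV => //; exact: measurable_cst.
have D00 w : 0 <= D0 w by rewrite lee_fin powR_ge0.
have D10 w : 0 <= D1 w by rewrite lee_fin powR_ge0.
have D20 w : 0 <= D2 w by rewrite lee_fin powR_ge0.
pose c : \bar R := (3%:R `^ (p - 1))%:E.
have c0 : 0 <= c by rewrite lee_fin powR_ge0.
apply: (@le_trans _ _ (\int[mu]_(w in cube r) (c * (D0 w + D1 w + D2 w)))).
  rewrite muleC -integral_cst_cube//; apply: ge0_le_integral => //.
  - by apply: measurable_funeM; apply: emeasurable_funD => //; exact: emeasurable_funD.
  move=> w _; rewrite -!EFinD -EFinM lee_fin.
  pose f k := nth 0%R [:: u x; u (x + w); u (x + w + h); u (x + h)]%R k.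
  have := powR_norm_telescope 3 f p1.
  rewrite !big_ord_recr big_ord0 /= add0r /f /= uxh sub0r normrN.
  by rewrite (addrAC x w h) (distrC _ (u (x + h + w)%R)).
rewrite ge0_integralZl//; last 2 first.
- by apply: emeasurable_funD => //; exact: emeasurable_funD.
- by move=> w _; rewrite !adde_ge0.
rewrite /morrey_pointwise_constant -mulrA EFinM -muleA; apply: lee_wpmul2l => //.
rewrite ge0_integralD//; last 2 first.
- by move=> w _; rewrite adde_ge0.
- exact: emeasurable_funD.
rewrite ge0_integralD//.
rewrite (_ : (_ * _)%:E = (morrey_constant * r `^ p)%:E + ((N%:R * r) `^ p)%:E +
   (morrey_constant * r `^ p)%:E); last first.
  rewrite -!EFinD powRM ?(ltW r0)//; congr EFin; ring.
have Kr0 : 0 <= (morrey_constant * r `^ p)%:E by rewrite lee_fin mulr_ge0.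
have Nr0 : 0 <= ((N%:R * r) `^ p)%:E by rewrite lee_fin powR_ge0.
rewrite (ge0_muleDl _ (adde_ge0 Kr0 Nr0) Kr0) (ge0_muleDl _ Kr0 Nr0).
have r34 : (3 * r <= 4 * r)%R by rewrite ler_pM2r// ler_nat.
apply: leeD; first apply: leeD.
- apply: (le_trans (osc_powR_le x r0)); apply: lee_wpmul2l.
    exact: Kr0.
  apply: ge0_subset_integral => //; first exact: measurable_funTS.
    by move=> w _; rewrite lee_fin powR_ge0.
  move=> w ws j; have := ws j; rewrite !in_itv/= -!ltr_norml => /lt_le_trans; exact.
- apply: translation_cube_le => //; first exact: ltW.
  lra.
(* The cube of half-side 3r around x + h lies in the one of half-side 4r around x. *)
- apply: (le_trans (osc_powR_le (x + h)%R r0)); apply: lee_wpmul2l.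
    exact: Kr0.
  under eq_integral => w _ do rewrite -addrA (addrC h).
  apply: (@ge0_integral_shift_le _ _ _ _ h (fun w => g (x + w)%R)) => //.
    by move=> w; rewrite lee_fin powR_ge0.
  move=> w ws j; have := ws j; rewrite !in_itv/= -!ltr_norml => wj.
  rewrite mxE (le_lt_trans (ler_normD _ _))// (@lt_le_trans _ _ (3 * r + r)%R)//.
    by rewrite ltr_leD.
  lra.
Qed.

(** Integrate [morrey_pointwise] over x. By Tonelli and translation invariance the local gradient
    integrals add up to the full one times the measure (8 r)^N of cube (4 r). *)
Lemma morrey_poincare (r : R) : (0 < r)%R ->
  (forall x, u x != 0%R -> exists h : 'rV[R]_N, (forall j, `|h ord0 j| <= r)%R /\ u (x + h)%R = 0%R) ->
  ((2 * r) ^+ N)%:E * \int[mu]_x (`|u x| `^ p)%:E <=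
  (morrey_pointwise_constant * r `^ p)%:E * (\int[mu]_x g x * ((8 * r) ^+ N)%:E).
Proof.
move=> r0 uh.
have mg : measurable_fun setT g by exact: measurable_grad_powR.
pose F (z : 'rV[R]_N * 'rV[R]_N) := g (z.1 + z.2)%R.
have mF : measurable_fun setT F by apply: (measurableT_comp mg); exact: measurable_funD_rV.
have F0 z : 0 <= F z by rewrite lee_fin powR_ge0.
have r4 : (0 < 4 * r)%R by rewrite mulr_gt0.
have mQ := @measurable_cube R N (4 * r).
have C0 : (0 <= morrey_pointwise_constant * r `^ p)%R.
  by rewrite mulr_ge0 ?powR_ge0// ltW// morrey_pointwise_constant_gt0.
have -> : \int[mu]_x g x * ((8 * r) ^+ N)%:E = \int[mu]_x \int[mu]_(w in cube (4 * r)) F (x, w).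
  rewrite tonelli_set//.
  have -> : (8 * r = 2 * (4 * r))%R by rewrite mulrA -natrM.
  rewrite -(integral_cst_cube _ _ r4).
  have g0 x : 0 <= g x by rewrite lee_fin powR_ge0.
  by apply: eq_integral => w _; rewrite -[LHS](ge0_integral_shift_rV w mg g0).
have mJ : measurable_fun setT (fun x => \int[mu]_(w in cube (4 * r)) F (x, w)).
  exact: measurable_integral_section.
have mup : measurable_fun setT (fun x => (`|u x| `^ p)%:E).
  apply/measurable_EFinP; apply: (measurableT_comp (measurable_powR p)).
  by apply: (measurableT_comp (@normr_measurable R setT)); exact: measurable_C1.
have r20 : 0 <= ((2 * r) ^+ N)%:E by rewrite lee_fin exprn_ge0// mulr_ge0// ltW.
have up0 x : setT x -> 0 <= (`|u x| `^ p)%:E by rewrite lee_fin powR_ge0.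
have J0 x : setT x -> 0 <= \int[mu]_(w in cube (4 * r)) F (x, w).
  by move=> _; exact: integral_ge0.
have C0' : 0 <= (morrey_pointwise_constant * r `^ p)%:E by rewrite lee_fin.
rewrite -(ge0_integralZl mu measurableT mup up0 r20) -(ge0_integralZl mu measurableT mJ J0 C0').
apply: ge0_le_integral => //.
- by move=> x _; rewrite mule_ge0// lee_fin powR_ge0.
- exact: measurable_funeM.
- exact: measurable_funeM.
move=> x _; have [ux|ux] := eqVneq (u x) 0%R.
  by rewrite ux normr0 powR0 ?gt_eqF// mule0 mule_ge0 ?lee_fin//; exact: integral_ge0.
by have [h [hr uxh]] := uh x ux; exact: morrey_pointwise uxh.
Qed.

End morrey.

(** * Euclidean balls and the first eigenvalue *)

Section balls.
Variables (R : realType) (N : nat).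
Local Notation mu := (lebesgue_rV R N).

Lemma coord_enorm_le (x : 'rV[R]_N) j : `|x ord0 j| <= enorm x.
Proof.
rewrite /enorm -sqrtr_sqr ler_sqrt; last by rewrite sumr_ge0// => i _; rewrite sqr_ge0.
by rewrite (bigD1 j)//= lerDl sumr_ge0// => i _; rewrite sqr_ge0.
Qed.

Lemma eball_subset_cube (r : R) : eball 0 r `<=` @cube R N r.
Proof.
move=> x; rewrite /eball/= subr0 => xr j; rewrite in_itv/= -ltr_norml.
exact: le_lt_trans (coord_enorm_le x j) xr.
Qed.

(** On this cube the squared norm is at most N r^2/(N+1)^2 < r^2; dividing by N + 1 also covers
    dimension 0. *)
Lemma cube_subset_eball (r : R) : 0 < r -> @cube R N (r / N.+1%:R) `<=` eball 0 r.
Proof.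
move=> r0 x xc; rewrite /eball/= subr0 /enorm -(ger0_norm (ltW r0)) -sqrtr_sqr ltr_sqrt ?exprn_gt0//.
apply: (@le_lt_trans _ _ (\sum_(i < N) (r / N.+1%:R) ^+ 2)).
  apply: ler_sum => j _; have := xc j; rewrite in_itv/= -ltr_norml => /ltW xj.
  by rewrite -real_normK ?num_real// lerXn2r ?nnegrE// divr_ge0// ltW.
rewrite sumr_const card_ord -[X in X < _]mulr_natl expr_div_n mulrCA gtr_pMr ?exprn_gt0//.
rewrite ltr_pdivrMr ?exprn_gt0 ?ltr0n// mul1r -natrX ltr_nat.
by rewrite (@leq_trans N.+1)// leq_pmulr.
Qed.

Lemma measurable_eball (x : 'rV[R]_N) (r : R) : measurable (eball x r).
Proof.
have me : measurable_fun setT (fun y : 'rV[R]_N => enorm (y + - x)).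
  have : measurable_fun setT (@enorm R N).
    apply: (measurableT_comp (@continuous_measurable_fun R _ (@sqrt_continuous R))).
    by apply: measurable_sum => i; apply: measurable_funX; exact: measurable_coord.
  by move=> /measurableT_comp; apply; exact: measurable_shift_rV.
have /(_ measurableT `]-oo, r[%classic) := me.
rewrite setTI (_ : _ @^-1` _ = eball x r); first by apply; exact: measurable_itv.
by apply/seteqP; split => y; rewrite /eball /= in_itv.
Qed.

Lemma open_eball_subset (Omega : set 'rV[R]_N) x : open Omega -> Omega x ->
  exists2 r : R, 0 < r & eball x r `<=` Omega.
Proof.
move=> oO Ox; have /nbhs_ballP [e /= e0 xeO] : nbhs x Omega by exact: open_nbhs_nbhs.
exists e => // y yx; apply: xeO; split=> // i j.
rewrite (ord1 i : i = ord0) /ball/= distrC.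
have := coord_enorm_le (y - x) j; rewrite !mxE => /le_lt_trans; exact.
Qed.

Local Open Scope ereal_scope.

Lemma lebesgue_rV_shift (h : 'rV[R]_N) (S : set 'rV[R]_N) : measurable S ->
  mu ((fun x : 'rV[R]_N => x + h)%R @^-1` S) = mu S.
Proof.
move=> mS.
have mS' : measurable ((fun x : 'rV[R]_N => x + h)%R @^-1` S).
  by rewrite -[X in measurable X]setTI; apply: (@measurable_shift_rV R N h).
have mI : measurable_fun setT (fun x : 'rV[R]_N => (\1_S x : R)%:E).
  by apply/measurable_EFinP; exact: measurable_indic.
have I0 (x : 'rV[R]_N) : 0 <= (\1_S x : R)%:E by rewrite lee_fin.
have := ge0_integral_shift_rV h mI I0.
rewrite [X in _ = X -> _]integral_indic// setIT => <-.
rewrite -[in LHS](setIT (_ @^-1` S)) -integral_indic//.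
Qed.

Lemma eball_measure_gt0 (r : R) : (0 < r)%R -> 0 < mu (eball 0%R r).
Proof.
move=> r0; have r1 : (0 < r / N.+1%:R)%R by rewrite divr_gt0.
have := le_measure mu (mem_set (@measurable_cube R N _)) (mem_set (measurable_eball 0%R r)) (cube_subset_eball r0).
apply: lt_le_trans; rewrite [X in _ < X](cube_measure N r1) lte_fin.
by rewrite exprn_gt0// mulr_gt0.
Qed.

Lemma eball_measure_fin (r : R) : (0 < r)%R -> mu (eball 0%R r) \is a fin_num.
Proof.
move=> r0; rewrite ge0_fin_numE//.
have := le_measure mu (mem_set (measurable_eball 0%R r)) (mem_set (@measurable_cube R N r)) (@eball_subset_cube r).
by move=> /le_lt_trans; apply; rewrite [X in X < _](cube_measure N r0) ltry.
Qed.

End balls.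

(** * Lower bounds for [lambda] from Poincare inequalities *)

Section lambda_bounds.
Variables (R : realType) (N : nat).
Local Notation mu := (lebesgue_rV R N).
Local Open Scope ereal_scope.

(** A test function and its gradient vanish off Omega, so all integrals pass to the whole space and
    the normalisation becomes a condition on the integral of |u|^p. *)
Lemma lambda_lower_bound (p : R) (Omega : set 'rV[R]_N) (c : \bar R) :
  (1 <= p)%R ->
  (forall u : 'rV[R]_N -> R, Ck 1 u -> compact (closure [set x | u x != 0%R]) ->
    (forall x, ~ Omega x -> u x = 0%R) -> \int[mu]_x (`|u x| `^ p)%:E = 1 ->
    c <= \int[mu]_x (enorm (grad u x) `^ p)%:E) ->
  c <= lambda p Omega.
Proof.
move=> p1 cu; have p0 : (0 < p)%R by exact: lt_le_trans p1.
apply: le_ereal_inf_tmp => _ [u [[sm_u supp_u uO] norm_u] <-].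
have u0 x : ~ Omega x -> u x = 0%R.
  by move=> nOx; apply: contrapT => /eqP ux; apply/nOx/uO/subset_closure.
have uE : u \_ Omega = u.
  apply/funext => x; rewrite /patch; case: ifPn => // /negP xO.
  by rewrite u0// => Ox; apply: xO; exact: mem_set.
have -> : \int[mu]_(x in Omega) (enorm (grad u x) `^ p)%:E = \int[mu]_x (enorm (grad u x) `^ p)%:E.
  rewrite integral_mkcond; apply: eq_integral => x _; rewrite /patch; case: ifPn => // /negP xO.
  have grad0 : grad u x = 0%R.
    apply/rowP => i; rewrite !mxE; apply: partial_eq0 => /uO Ox.
    by apply: xO; exact: mem_set.
  rewrite grad0 /enorm big1 ?sqrtr0 ?powR0 ?gt_eqF// => i _.
  by rewrite mxE expr0n.
apply: cu (sm_u 1%N) supp_u u0 _.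
have := powR_Lnorm mu (EFin \o u) (lt0r_neq0 p0).
by rewrite uE in norm_u; rewrite norm_u poweR1r => ->.
Qed.

(** Contrapositive: if Omega fills less than the proportion beta of every ball of radius r, the
    zeros of u fill at least 1 - beta of each. Then [poincare_zero_density] applies with kappa = (1
    - beta)|B|, and |B| cancels. *)
Lemma exists_eball_measure_ge (p : R) (Omega : set 'rV[R]_N) (beta r : R) :
  (0 < N)%N -> (1 <= p)%R -> open Omega -> (beta < 1)%R -> (0 < r)%R ->
  lambda p Omega < ((1 - beta) / (N%:R * r) `^ p)%:E ->
  exists x0, beta%:E * mu (eball x0 r) <= mu (eball x0 r `&` Omega).
Proof.
move=> N0 p1 oO b1 r0; apply: contraPP => /forallNP small.
apply/negP; rewrite -leNgt; apply: lambda_lower_bound => // u u1 supp_u uO norm_u.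
have mO := open_measurable_rV oO.
set B := eball (0 : 'rV[R]_N) r.
have mB : measurable B by exact: measurable_eball.
have Bfin : mu B \is a fin_num by exact: eball_measure_fin.
pose b := fine (mu B).
have bE : mu B = b%:E by rewrite fineK.
have b0 : (0 < b)%R by rewrite -lte_fin -bE; exact: eball_measure_gt0.
have shiftB x : (fun h : 'rV[R]_N => h + x)%R @^-1` (eball x r) = B.
  by apply/seteqP; split => h; rewrite /B /eball /= addrK subr0.
have mZ x : measurable (B `&` [set h | u (x + h)%R = 0%R]).
  apply: measurableI => //.
  have /(_ measurableT [set 0%R]) : measurable_fun setT (fun h : 'rV[R]_N => u (x + h)%R).
    apply: (measurableT_comp (measurable_C1 u1)).
    by apply: measurable_funD_rV => //; exact: measurable_cst.
  by rewrite setTI; apply; exact: measurable_set1.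
have density x : ((1 - beta) * b)%:E <= mu (B `&` [set h | u (x + h)%R = 0%R]).
  have E : mu (B `&` (fun h : 'rV[R]_N => h + x)%R @^-1` Omega) < (beta * b)%:E.
    rewrite -(shiftB x) -preimage_setI lebesgue_rV_shift; last first.
      by apply: measurableI => //; exact: measurable_eball.
    have /negP := small x; rewrite -ltNge => /lt_le_trans; apply.
    rewrite EFinM -bE -(shiftB x) lebesgue_rV_shift//; exact: measurable_eball.
  have mBO : measurable (B `&` (fun h : 'rV[R]_N => h + x)%R @^-1` Omega).
    apply: measurableI => //; rewrite -[X in measurable X]setTI.
    exact: (@measurable_shift_rV R N x).
  have BD : mu B <= (beta * b)%:E + mu (B `&` [set h | u (x + h)%R = 0%R]).
    apply: (@le_trans _ _ (mu ((B `&` (fun h : 'rV[R]_N => h + x)%R @^-1` Omega) `|`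
        (B `&` [set h | u (x + h)%R = 0%R])))).
      apply: le_measure; rewrite ?inE//; first exact: measurableU.
      move=> h Bh; have [Oh|nOh] := pselect (Omega (h + x)%R); [by left|right].
      by split => //=; rewrite addrC; exact: uO.
    apply: (le_trans (measureU2 _ mBO (mZ x))).
    by apply: leeD => //; exact: ltW.
  by rewrite mulrBl mul1r EFinB leeBlDl// -bE.
have Nr0 : (0 < (N%:R * r) `^ p)%R by rewrite powR_gt0// mulr_gt0// ltr0n.
have k0 : (0 <= (1 - beta) * b)%R by rewrite mulr_ge0 ?(ltW b0)// subr_ge0 ltW.
have := poincare_zero_density u1 supp_u p1 mB (ltW r0) k0 _ (fun x _ => density x).
rewrite norm_u mule1 bE => H.
have {H} : ((1 - beta) * b)%:E <= ((N%:R * r) `^ p)%:E * \int[mu]_x (enorm (grad u x) `^ p)%:E * b%:E.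
  apply: H => k kB j; have := eball_subset_cube kB j; rewrite in_itv/= -ltr_norml; exact: ltW.
rewrite EFinM lee_pmul2r// => H.
by rewrite EFinM lee_pdivrMr// muleC.
Qed.

End lambda_bounds.

(** * Choice of the constants and of the radius *)

Lemma exists_morrey_weight (R : realType) (N : nat) (p : R) : 1 < p -> N%:R < p ->
  exists2 t : R, 0 < t < 1 & (1 - t) `^ (1 - p) * (2 ^+ N / 2 `^ p) < 1.
Proof.
move=> p1 Np; set q := 2 ^+ N / 2 `^ p.
have q0 : 0 < q by rewrite divr_gt0 ?exprn_gt0 ?powR_gt0.
have q1 : q < 1.
  rewrite /q ltr_pdivrMr ?powR_gt0// mul1r -powR_mulrn// /powR !gt_eqF//.
  by rewrite ltr_expR ltr_pM2r// ln_gt0// ltr1n.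
(* With 1 - t = theta^(1/(p-1)) the product in question is q/theta, which is below 1 because q <
   theta; theta < 1 ensures t > 0. *)
pose theta := (1 + q) / 2.
have th0 : 0 < theta by rewrite divr_gt0// addr_gt0.
have th1 : theta < 1 by rewrite ltr_pdivrMr// mul1r; lra.
have pp : 0 < (p - 1)^-1 by rewrite invr_gt0 subr_gt0.
exists (1 - theta `^ (p - 1)^-1).
  rewrite subr_gt0 gtrBl powR_gt0// andbT.
  have := gt0_ltr_powR pp; move=> /(_ theta 1); rewrite !nnegrE (ltW th0) ler01 => /(_ isT isT th1).
  by rewrite powR1.
rewrite subKr -powRrM -(opprB p 1) mulrN mulVf ?subr_eq0 ?gt_eqF//.
rewrite powR_inv1 ?(ltW th0)// /theta invf_div mulrAC ltr_pdivrMr ?addr_gt0// mul1r.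
lra.
Qed.

(** Contrapositive: if no ball of radius r lies in Omega, each B_r(x) contains a point off Omega,
    hence a zero of u, and [morrey_poincare] bounds [lambda] from below. *)
Lemma exists_eball_subset (R : realType) (N : nat) (p : R) :
  (0 < N)%N -> 1 < p -> N%:R < p -> exists2 C : R, 0 < C &
  forall (Omega : set 'rV[R]_N) (r : R), 0 < r ->
    (lambda p Omega < (C / r `^ p)%:E)%E -> exists x0, eball x0 r `<=` Omega.
Proof.
move=> N0 p1 Np; have [t t01 Aq] := exists_morrey_weight p1 Np.
pose C1 := morrey_pointwise_constant N p t.
have C10 : 0 < C1 by exact: morrey_pointwise_constant_gt0.
(* The quotient of (8 r)^N by (2 r)^N in [morrey_poincare] leaves 4^N. *)
exists (C1 * 4 ^+ N)^-1; first by rewrite invr_gt0 mulr_gt0 ?exprn_gt0.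
move=> Omega r r0; apply: contraPP => /forallNP small.
apply/negP; rewrite -leNgt.
apply: (lambda_lower_bound (ltW p1)) => u u1 supp_u uO norm_u.
have zero x : u x != 0 -> exists h : 'rV[R]_N, (forall j, `|h ord0 j| <= r) /\ u (x + h) = 0.
  move=> _; have /existsNP[y /not_implyP[yx nOy]] := small x.
  have E : x + (y - x) = y by rewrite addrC subrK.
  exists (y - x); rewrite E; split=> [j|]; last exact: uO.
  by apply: (le_trans (coord_enorm_le _ _)); exact: ltW.
have := morrey_poincare u1 supp_u (ltW p1) t01 Aq N0 r0 zero.
rewrite norm_u mule1 -/C1; set I := (\int[_]_x _)%E => H.
have rp : 0 < r `^ p by rewrite powR_gt0.
rewrite -invfM; set D := C1 * 4 ^+ N * r `^ p.
have D0 : 0 < D by rewrite /D mulr_gt0// mulr_gt0// exprn_gt0.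
rewrite -(mule1 (D^-1)%:E) lee_pdivrMl//.
have r2N : 0 < (2 * r) ^+ N by rewrite exprn_gt0// mulr_gt0.
have E8 : (8 * r) ^+ N = (2 * r) ^+ N * 4 ^+ N by rewrite -exprMn; congr (_ ^+ _); ring.
rewrite -(lee_pmul2l (x := ((2 * r) ^+ N)%:E))// mule1; apply: (le_trans H).
rewrite E8 (muleC I) !muleA -!EFinM le_eqVlt; apply/orP; left; apply/eqP.
by congr (_%:E * _)%E; rewrite /D; ring.
Qed.

(** Take r = alpha/l^(1/p), the smallest radius allowed. Then c/r^p = l c/alpha^p, which exceeds l
    because alpha^p < c. *)
Lemma exists_radius (R : realType) (p c alpha : R) (l : \bar R) :
  0 < p -> 0 < alpha -> alpha `^ p < c -> (0 < l < +oo)%E ->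
  exists r : R, [/\ 0 < r, (alpha%:E / l `^ p^-1 <= r%:E)%E & (l < (c / r `^ p)%:E)%E].
Proof.
move=> p0 al0 alc; case: l => [l| |]//; last by rewrite ltxx andbF.
rewrite lte_fin => /andP[l0 _].
have lp : 0 < l `^ p^-1 by rewrite powR_gt0.
exists (alpha / l `^ p^-1); split; first by rewrite divr_gt0.
  by rewrite poweR_EFin inver gt_eqF// -EFinM.
rewrite lte_fin powRM ?invr_ge0 ?(ltW al0) ?(ltW lp)// powRV ?(ltW lp)// -powRrM mulVf ?gt_eqF//.
rewrite powRr1 ?(ltW l0)// invf_div mulrCA ltr_pMr// ltr_pdivlMr ?mul1r//.
by rewrite powR_gt0.
Qed.

Unset Implicit Arguments.

Theorem theorem3p3 (R : realType) (N : nat) (hN : (2 <= N)%N) :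
  (forall p : R, 1 <= p <= N%:R ->
    exists alpha : R -> R,
      (forall beta : R, 0 < beta < 1 ->
        0 < alpha beta /\
        forall Omega : set 'rV[R]_N,
          open Omega -> Omega !=set0 -> (0 < lambda p Omega)%E ->
          exists (x0 : 'rV[R]_N) (r : R), 0 < r /\
            ((alpha beta)%:E / (lambda p Omega) `^ p^-1 <= r%:E)%E /\
            (beta%:E * lebesgue_rV R N (eball x0 r)
               <= lebesgue_rV R N (eball x0 r `&` Omega))%E) /\
      sim_at1 alpha (fun beta => (1 - beta) `^ p^-1)) /\
  (forall p : R, N%:R < p ->
    exists alpha : R,
      0 < alpha /\
      forall Omega : set 'rV[R]_N,
        open Omega -> Omega !=set0 -> (0 < lambda p Omega)%E ->
        exists (x0 : 'rV[R]_N) (r : R), 0 < r /\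
          (alpha%:E / (lambda p Omega) `^ p^-1 <= r%:E)%E /\
          eball x0 r `<=` Omega).
Proof.
have N0 : (0 < N)%N by exact: leq_trans hN.
have Nr0 : 0 < (N%:R : R) by rewrite ltr0n.
have [mu_le1 ball_in] : (forall (beta : R) (A : set 'rV[R]_N), beta < 1 ->
      (beta%:E * lebesgue_rV R N A <= lebesgue_rV R N A)%E) /\
    (forall (p alpha : R) (Omega : set 'rV[R]_N), 1 <= p -> open Omega ->
      Omega !=set0 -> lambda p Omega = +oo%E -> exists (x0 : 'rV[R]_N) (r : R),
      [/\ 0 < r, (alpha%:E / (lambda p Omega) `^ p^-1 <= r%:E)%E & eball x0 r `<=` Omega]).
  split=> [beta A b1|p alpha Omega p1 oO [x Ox] ->].
    by rewrite -[leRHS]mul1e lee_wpmul2r// lee_fin ltW.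
  (* When [lambda] is infinite the lower bound on the radius is alpha/(+oo) = 0, so any ball inside
     Omega will do. *)
  have [r r0 xr] := open_eball_subset oO Ox; exists x, r; split=> //.
  rewrite poweRyr ?invr_eq0 ?gt_eqF// ?(lt_le_trans _ p1)//.
  by rewrite invey mule0 lee_fin ltW.
split=> [p /andP[p1 _]|p Np].
  have p0 : 0 < p by exact: lt_le_trans p1.
  (* The factor 2 makes alpha^p < (1 - beta)/N^p strict, as [exists_radius] requires. *)
  exists (fun beta => (1 - beta) `^ p^-1 / (2 * N%:R)); split=> [beta /andP[_ b1]|].
    have b0 : 0 < 1 - beta by rewrite subr_gt0.
    set al := (1 - beta) `^ p^-1 / (2 * N%:R).
    have al0 : 0 < al by rewrite divr_gt0 ?powR_gt0 ?mulr_gt0.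
    split=> // Omega oO On0 l0.
    have [ly|ly] := eqVneq (lambda p Omega) +oo%E.
      have [x [r [r0 xr xO]]] := ball_in p al Omega p1 oO On0 ly.
      exists x, r; split=> //; split; first exact: xr.
      by rewrite (setIidl xO); exact: mu_le1.
    have lfin : (0 < lambda p Omega < +oo)%E by rewrite l0 ltey.
    have [|r [r0 xr lr]] := @exists_radius R p ((1 - beta) / N%:R `^ p) al _ p0 al0 _ lfin.
      rewrite /al powRM ?invr_ge0 ?powR_ge0 ?mulr_ge0// -powRrM mulVf ?gt_eqF// powRr1 ?ltW//.
      rewrite ltr_pM2l// powRV ?mulr_ge0// ltf_pV2 ?posrE ?powR_gt0 ?mulr_gt0//.
      rewrite gt0_ltr_powR ?nnegrE ?mulr_ge0//.
      by rewrite ltr_pMl// ltr1n.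
    have [|x xO] := exists_eball_measure_ge N0 p1 oO b1 r0.
      by rewrite powRM// ?(ltW r0)// invfM mulrA.
    by exists x, r.
  (* The ratio of alpha to (1 - beta)^(1/p) is constantly 1/(2N) for beta < 1, so one number serves
     as both bounds. *)
  exists (2 * N%:R)^-1, (2 * N%:R)^-1.
  have c0 : 0 < (2 * N%:R : R)^-1 by rewrite invr_gt0 mulr_gt0.
  split=> //; apply: filterS (@nbhs_left_lt R 1) => b b1.
  have b0 : (1 - b) `^ p^-1 != 0 by rewrite gt_eqF// powR_gt0// subr_gt0.
  by rewrite mulrAC divff// mul1r lexx.
have p1 : 1 < p.
  by apply: lt_trans Np; rewrite ltr1n.
have p0 : 0 < p by exact: lt_trans p1.
have [C C0 CP] := exists_eball_subset N0 p1 Np.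
have C2 : 0 < C / 2 by rewrite divr_gt0.
have al0 : 0 < (C / 2) `^ p^-1 by rewrite powR_gt0.
(* Here alpha^p = C/2 lies strictly below C. *)
exists ((C / 2) `^ p^-1); split=> // Omega oO On0 l0.
have [ly|ly] := eqVneq (lambda p Omega) +oo%E.
  have [x [r [r0 xr xO]]] := ball_in p ((C / 2) `^ p^-1) Omega (ltW p1) oO On0 ly.
  by exists x, r.
have lfin : (0 < lambda p Omega < +oo)%E by rewrite l0 ltey.
have [|r [r0 xr lr]] := @exists_radius R p C _ _ p0 al0 _ lfin.
  by rewrite -powRrM mulVf ?gt_eqF// powRr1 ?ltW// gtr_pMr// invf_lt1// ltr1n.
by have [x xO] := CP Omega r r0 lr; exists x, r.
Qed.
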